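(* Let $F$ be a field of characteristic zero and let $\beta>2$ be an arbitrary real number. Then there exists a (not necessarily associative) $F$-algebra $R_\beta$ with $\underline{exp}(R_\beta)=1$ and $\overline{exp}(R_\beta)=\beta$ such that the ordinary PI-exponent $\lim_{n\to\infty}\sqrt[n]{c_n(R_\beta^\sharp)}$ of the unital algebra $R_\beta^\sharp$ does not exist. Moreover, $\underline{exp}(R_\beta^\sharp)=2$, whereas $\beta\le\overline{exp}(R_\beta^\sharp)\le\beta+1$.
   Context: Algebras are over a field $F$ of characteristic zero, not necessarily associative, unital or finite-dimensional. Let $F\{X\}$ be the free (non-associative) $F$-algebra on a countably infinite set $X=\{x_1,x_2,\ldots\}$ of free generators, and let $Id(A)\subset F\{X\}$ be the ideal of all polynomial identities of an algebra $A$. Let $P_n=P_n(x_1,\ldots,x_n)$ be the subspace of $F\{X\}$ of all multilinear polynomials in $x_1,\ldots,x_n$ (each monomial, with any arrangement of brackets, containing each of $x_1,\ldots,x_n$ exactly once). The $n$-th codimension of $A$ is $$c_n(A)=\dim\frac{P_n}{P_n\cap Id(A)},\quad n=1,2,\ldots.$$ If the sequence $\{c_n(A)\}$ is exponentially bounded, the lower and upper PI-exponents of $A$ are $$\underline{exp}(A)=\liminf_{n\to\infty}\sqrt[n]{c_n(A)},\qquad \overline{exp}(A)=\limsup_{n\to\infty}\sqrt[n]{c_n(A)},$$ and the (ordinary) PI-exponent of $A$ is $exp(A)=\lim_{n\to\infty}\sqrt[n]{c_n(A)}$ when this limit exists. For an algebra $A$, $A^\sharp$ denotes the algebra obtained from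 $A$ by adjoining an external unit, i.e. $A^\sharp=F\cdot 1\oplus A$ as a vector space, where $1$ acts as a two-sided identity element and $A$ is an ideal with its original multiplication. *)

(* Defs.v *)
From HB Require Import structures.
From mathcomp Require Import all_boot all_order all_algebra finmap.
From mathcomp Require Import all_classical all_reals all_analysis.
(* The notations of monalg are incompatible with those of mathcomp-analysis. *)
From mathcomp Require Import -(notations) monalg.

Set Implicit Arguments.
Unset Strict Implicit.
Unset Printing Implicit Defensive.

Import Order.TTheory GRing.Theory Num.Theory.
Import numFieldNormedType.Exports.

Local Open Scope classical_set_scope.
Local Open Scope ring_scope.

HB.mixin Record Lmodule_isNonAssocAlgebra (F : fieldType) A
    of GRing.Lmodule F A := {
  namul : A -> A -> A;
  namulDl : left_distributive namul +%R;
  namulDr : right_distributive namul +%R;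
  namulZl : forall (a : F) x y, namul (a *: x) y = a *: namul x y;
  namulZr : forall (a : F) x y, namul x (a *: y) = a *: namul x y
}.

#[short(type="nonAssocAlgType")]
HB.structure Definition NonAssocAlgebra (F : fieldType) :=
  {A of Lmodule_isNonAssocAlgebra F A & GRing.Lmodule F A}.

(* Nonassociative monomials: the free magma on the generators x_i, i : nat. *)
Inductive naword := NaVar of nat | NaMul of naword & naword.

Fixpoint tree_of_naword (w : naword) : GenTree.tree nat :=
  match w with
  | NaVar i => GenTree.Leaf i
  | NaMul u v => GenTree.Node 0 [:: tree_of_naword u; tree_of_naword v]
  end.

Fixpoint naword_of_tree (t : GenTree.tree nat) : option naword :=
  match t with
  | GenTree.Leaf i => Some (NaVar i)
  | GenTree.Node 0 [:: t1; t2] =>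
      if (naword_of_tree t1, naword_of_tree t2) is (Some u, Some v)
      then Some (NaMul u v) else None
  | _ => None
  end.

Lemma tree_of_nawordK : pcancel tree_of_naword naword_of_tree.
Proof. by elim=> [i|u /= -> v /= ->]. Qed.

HB.instance Definition _ :=
  Choice.copy naword (pcan_type tree_of_nawordK).

Fixpoint navars (w : naword) : seq nat :=
  match w with
  | NaVar i => [:: i]
  | NaMul u v => navars u ++ navars v
  end.

(* The free nonassociative algebra F{X}, with basis the monomials. *)
Definition freeNaAlg (F : fieldType) : Type := malg naword F.
HB.instance Definition _ (F : fieldType) :=
  GRing.Lmodule.copy (freeNaAlg F) (malg naword F).

Section LinearExtension.
Variables (F : fieldType) (V : lmodType F).
Implicit Types (h : naword -> V) (f g : freeNaAlg F).

Definition linext h f : V := \sum_(w <- msupp f) mcoeff w f *: h w.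

Lemma linextEw h f (d : {fset naword}) : (msupp f `<=` d)%fset ->
  linext h f = \sum_(w <- d) mcoeff w f *: h w.
Proof.
move=> sfd; rewrite /linext (big_fset_incl _ sfd)// => w _ wf.
by rewrite (mcoeff_outdom wf) scale0r.
Qed.

Lemma linextD h : {morph linext h : f g / f + g}.
Proof.
move=> f g; pose d := (msupp f `|` msupp g)%fset.
rewrite (@linextEw h (f + g) d) ?(@linextEw h f d) ?(@linextEw h g d) //.
- by rewrite -big_split; apply: eq_bigr => w _; rewrite mcoeffD scalerDl.
- exact: fsubsetUr.
- exact: fsubsetUl.
- exact: msuppD_le.
Qed.

Lemma linextZ h a f : linext h (a *: f) = a *: linext h f.
Proof.
rewrite (@linextEw h (a *: f) (msupp f)) ?msuppZ_le// /linext scaler_sumr.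
by apply: eq_bigr => w _; rewrite mcoeffZ scalerA.
Qed.

Lemma linextU h w : linext h (mkmalgU w 1) = h w.
Proof.
rewrite (@linextEw h _ [fset w]%fset) ?msuppU_le// big_seq_fset1.
by rewrite mcoeffUU scale1r.
Qed.

Lemma linext_sum h1 h2 f :
  linext (fun w => h1 w + h2 w) f = linext h1 f + linext h2 f.
Proof. by rewrite /linext -big_split; apply: eq_bigr => w _; rewrite scalerDr. Qed.

Lemma linext_scale a h f : linext (fun w => a *: h w) f = a *: linext h f.
Proof.
rewrite /linext scaler_sumr; apply: eq_bigr => w _.
by rewrite !scalerA mulrC.
Qed.

End LinearExtension.

Section FreeNaAlgMul.
Variable F : fieldType.
Implicit Types f g : freeNaAlg F.

Definition freeNaMul f g : freeNaAlg F :=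
  linext (fun u => linext (fun v => mkmalgU (NaMul u v) 1 : freeNaAlg F) g) f.

Lemma freeNaMulDl : left_distributive freeNaMul +%R.
Proof. by move=> f1 f2 g; exact: linextD. Qed.

Lemma freeNaMulDr : right_distributive freeNaMul +%R.
Proof.
move=> f g1 g2; rewrite /freeNaMul -linext_sum; congr linext.
by apply/funext => u; rewrite linextD.
Qed.

Lemma freeNaMulZl a f g : freeNaMul (a *: f) g = a *: freeNaMul f g.
Proof. exact: linextZ. Qed.

Lemma freeNaMulZr a f g : freeNaMul f (a *: g) = a *: freeNaMul f g.
Proof.
rewrite /freeNaMul -linext_scale; congr linext.
by apply/funext => u; rewrite linextZ.
Qed.

HB.instance Definition _ := Lmodule_isNonAssocAlgebra.Build F (freeNaAlg F)
  freeNaMulDl freeNaMulDr freeNaMulZl freeNaMulZr.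

End FreeNaAlgMul.

Section PolynomialIdentities.
Variables (F : fieldType) (A : nonAssocAlgType F).
Implicit Types (phi : nat -> A) (f g : freeNaAlg F).

Fixpoint naword_eval phi (w : naword) : A :=
  match w with
  | NaVar i => phi i
  | NaMul u v => namul (naword_eval phi u) (naword_eval phi v)
  end.

Definition naeval phi f : A := linext (naword_eval phi) f.

Lemma naeval_namul phi f g :
  naeval phi (namul f g) = namul (naeval phi f) (naeval phi g).
Proof.
have ext_linext (h : naword -> freeNaAlg F) f' :
    naeval phi (linext h f') = linext (fun w => naeval phi (h w)) f'.
  rewrite [linext h f']/linext [RHS]/linext.
  elim/big_rec2: _ => [|w y1 y2 _ <-].
    by rewrite -(scale0r 0) [LHS]linextZ !scale0r.
  by rewrite [LHS]linextD linextZ.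
have mulDl y : {morph (fun x : A => namul x y) : x1 x2 / x1 + x2}.
  by move=> x1 x2; rewrite namulDl.
have mulDr x : {morph (fun y : A => namul x y) : y1 y2 / y1 + y2}.
  by move=> y1 y2; rewrite namulDr.
have mul0l y : namul 0 y = 0 :> A by rewrite -(scale0r 0) namulZl !scale0r.
have mul0r x : namul x 0 = 0 :> A by rewrite -(scale0r 0) namulZr !scale0r.
rewrite [namul f g]/(freeNaMul f g) ext_linext [naeval phi f]/linext.
rewrite [LHS]/linext (big_morph _ (mulDl _) (mul0l _)).
apply: eq_bigr => u _; rewrite ext_linext namulZl; congr (_ *: _).
rewrite [naeval phi g]/linext [LHS]/linext (big_morph _ (mulDr _) (mul0r _)).
by apply: eq_bigr => v _; rewrite [naeval _ _]linextU namulZr.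
Qed.

Definition polyIdent : set (freeNaAlg F) :=
  [set f | forall phi, naeval phi f = 0].

End PolynomialIdentities.

(* P_n; the variables of its polynomials are numbered from 1 to n. *)
Definition multilinear (F : fieldType) (n : nat) : set (freeNaAlg F) :=
  [set f | forall w, w \in msupp f -> perm_eq (navars w) (iota 1 n)].

Section QuotientDimension.
Variables (F : fieldType) (V : lmodType F).
Implicit Types P W : set V.

Definition quot_free W k (e : 'I_k -> V) : Prop :=
  forall c : 'I_k -> F, W (\sum_i c i *: e i) -> forall i, c i = 0.

(* For subspaces W `<=` P: the classes of the e i form a basis of P / W. *)
Definition quot_basis P W k (e : 'I_k -> V) : Prop :=
  [/\ forall i, P (e i),
      quot_free W e &
      forall v, P v -> exists c : 'I_k -> F, W (v - \sum_i c i *: e i)].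

(* The dimension of P / W, with value 0 if it is infinite. *)
Definition quot_dim P W : nat :=
  xget 0%N [set k | exists e : 'I_k -> V, quot_basis P W e].

Definition subspace W : Prop :=
  W 0 /\ forall a v1 v2, W v1 -> W v2 -> W (a *: v1 + v2).

Lemma subspace_sum W (I : finType) (c : I -> F) (e : I -> V) :
  subspace W -> (forall i, W (e i)) -> W (\sum_i c i *: e i).
Proof.
case=> W0 WD We; elim/big_rec: _ => // i v _ Wv.
exact: WD (We i) Wv.
Qed.

Lemma quot_free_le P W k l (e : 'I_k -> V) (b : 'I_l -> V) :
  subspace W -> (forall i, P (e i)) -> quot_free W e -> quot_basis P W b ->
  (k <= l)%N.
Proof.
move=> Wsub Pe Fe [_ _ spanb].
have [m mP] := choice (fun i => spanb _ (Pe i)).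
pose M : 'M[F]_(k, l) := \matrix_(i, j) m i j.
rewrite leqNgt; apply/negP => ltlk.
have : kermx M != 0.
  by rewrite -mxrank_eq0 mxrank_ker subn_eq0 -ltnNge (leq_ltn_trans _ ltlk)// rank_leq_col.
case/rowV0Pn => u /sub_kermxP uM /eqP; apply; apply/rowP => i; rewrite mxE.
apply: (Fe (u 0)); rewrite (_ : \sum_i _ =
    \sum_i u 0 i *: (e i - \sum_j m i j *: b j)); last first.
  under [RHS]eq_bigr do rewrite scalerBr.
  rewrite sumrB [X in _ - X](_ : _ = 0) ?subr0//.
  under eq_bigr do rewrite scaler_sumr.
  rewrite exchange_big big1// => j _.
  under eq_bigr do rewrite scalerA.
  rewrite -scaler_suml (_ : \sum_i _ = 0) ?scale0r//.
  move/rowP: uM => /(_ j); rewrite !mxE => uMj; rewrite -[RHS]uMj.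
  by apply: eq_bigr => i' _; rewrite mxE.
exact: subspace_sum.
Qed.

Lemma quot_dim_eq P W k (e : 'I_k -> V) :
  subspace W -> quot_basis P W e -> quot_dim P W = k.
Proof.
move=> Wsub eB; apply: xget_unique => /=; first by exists e.
move=> l [b bB]; have [[Pe Fe _] [Pb Fb _]] := (eB, bB).
by apply/eqP; rewrite eqn_leq (quot_free_le Wsub Pe Fe bB) (quot_free_le Wsub Pb Fb eB).
Qed.

Lemma quot_dimP P W N : subspace W ->
  (forall k (e : 'I_k -> V), (forall i, P (e i)) -> quot_free W e ->
     (k <= N)%N) ->
  exists e : 'I_(quot_dim P W) -> V, quot_basis P W e.
Proof.
move=> Wsub leN; pose Q k := `[< exists e : 'I_k -> V,
  (forall i, P (e i)) /\ quot_free W e >].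
have exQ : exists k, Q k.
  exists 0%N; apply/asboolP; exists (fun=> 0); split; first by case.
  by move=> c _ [].
have ubQ k : Q k -> (k <= N)%N by move=> /asboolP[e []]; exact: leN.
case: (ex_maxnP exQ ubQ) => k /asboolP[e [Pe Fe]] maxk.
suff eB : quot_basis P W e by rewrite (quot_dim_eq Wsub eB); exists e.
split=> // v Pv; apply: contrapT => nspan.
suff /maxk : Q k.+1 by rewrite ltnn.
pose e' (i : 'I_k.+1) := if unlift ord0 i is Some j then e j else v.
apply/asboolP; exists e'; split.
  by move=> i; rewrite /e'; case: unliftP.
have e'0 : e' ord0 = v by rewrite /e' unlift_none.
have e'S j : e' (lift ord0 j) = e j by rewrite /e' liftK.
move=> c; rewrite big_ord_recl e'0; under eq_bigr do rewrite e'S.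
move=> Wc; have [c0|c0] := eqVneq (c ord0) 0.
  move: Wc; rewrite c0 scale0r add0r => /Fe cS i.
  by case: (unliftP ord0 i) => [j|] ->.
case: nspan; exists (fun j => - (c ord0)^-1 * c (lift ord0 j)).
have := Wsub.2 (c ord0)^-1 _ _ Wc Wsub.1.
rewrite addr0 scalerDr scalerA mulVf// scale1r scaler_sumr -sumrN.
by under eq_bigr do [rewrite scalerA -[_ *: _]opprK -scaleNr -mulNr]; rewrite sumrN.
Qed.

End QuotientDimension.

Definition codim (F : fieldType) (A : nonAssocAlgType F) (n : nat) : nat :=
  quot_dim (@multilinear F n) (@multilinear F n `&` @polyIdent F A).

Section CodimTheory.
Variables (F : fieldType) (A : nonAssocAlgType F).
Implicit Types (f g : freeNaAlg F).

Lemma subspace_multilinear_polyIdent n :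
  subspace (@multilinear F n `&` @polyIdent F A).
Proof.
split.
  split=> [w /=|phi]; first by rewrite msupp0 in_fset0.
  by rewrite -(scale0r 0) [LHS]linextZ scale0r.
move=> a f g [mf If] [mg Ig]; split=> [w|phi].
  move/(fsubsetP (msuppD_le _ _)); rewrite in_fsetU.
  by case/orP => [/(fsubsetP (msuppZ_le _ _))/mf|/mg].
by rewrite [LHS]linextD linextZ -!/(naeval _ _) If Ig scaler0 addr0.
Qed.

Fixpoint nawords (s : seq nat) (d : nat) : seq naword :=
  if d is d'.+1 then
    map NaVar s ++ [seq NaMul u v | u <- nawords s d', v <- nawords s d']
  else [::].

Lemma mem_nawords s d w : (size (navars w) <= d)%N ->
  {subset navars w <= s} -> w \in nawords s d.
Proof.
have szgt0 w' : (0 < size (navars w'))%N.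
  by elim: w' => //= u IHu v _; rewrite size_cat addn_gt0 IHu.
elim: d w => [|d IH] [i|u v] /=.
- by [].
- by move=> + _; rewrite size_cat leqn0 addn_eq0 -leqn0 leqNgt szgt0.
- by move=> _ sub; rewrite mem_cat map_f// sub// mem_head.
move=> sz sub; rewrite mem_cat; apply/orP; right; apply: allpairs_f; apply: IH.
- move: sz; rewrite size_cat; apply: contraTT; rewrite -!ltnNge => lt_d.
  by rewrite -addn1 leq_add.
- by move=> i iu; apply: sub; rewrite mem_cat iu.
- move: sz; rewrite size_cat addnC; apply: contraTT; rewrite -!ltnNge => lt_d.
  by rewrite -addn1 leq_add.
- by move=> i iv; apply: sub; rewrite mem_cat iv orbT.
Qed.

Lemma multilinear_free_le n k (e : 'I_k -> freeNaAlg F) :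
  (forall i, @multilinear F n (e i)) ->
  quot_free (@multilinear F n `&` @polyIdent F A) e ->
  (k <= size (nawords (iota 1 n) n))%N.
Proof.
move=> Pe Fe; set s := nawords _ _.
pose M : 'M[F]_(k, size s) := \matrix_(i, j) mcoeff (nth (NaVar 0) s j) (e i).
rewrite leqNgt; apply/negP => ltsk.
have : kermx M != 0.
  by rewrite -mxrank_eq0 mxrank_ker subn_eq0 -ltnNge (leq_ltn_trans _ ltsk)// rank_leq_col.
case/rowV0Pn => u /sub_kermxP uM /eqP; apply; apply/rowP => i; rewrite mxE.
apply: (Fe (u 0)); rewrite (_ : \sum_i _ = 0).
  exact: (subspace_multilinear_polyIdent n).1.
apply/malgP => w; rewrite mcoeff0 raddf_sum /=.
have [ws|ws] := boolP (w \in s).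
  move/rowP: uM => /(_ (Ordinal (etrans (index_mem w s) ws))); rewrite !mxE => uMw.
  by rewrite -[RHS]uMw; apply: eq_bigr => j _; rewrite mcoeffZ mxE nth_index.
rewrite big1// => j _; rewrite mcoeffZ mcoeff_outdom ?mulr0//.
apply: contra ws => /(Pe j) wn; apply: mem_nawords.
  by rewrite (perm_size wn) size_iota.
by move=> x; rewrite (perm_mem wn).
Qed.

Lemma codimP n : exists e : 'I_(codim A n) -> freeNaAlg F,
  quot_basis (@multilinear F n) (@multilinear F n `&` @polyIdent F A) e.
Proof.
apply: quot_dimP (subspace_multilinear_polyIdent n) _.
exact: multilinear_free_le.
Qed.

Lemma codim_eq n k (e : 'I_k -> freeNaAlg F) :
  quot_basis (@multilinear F n) (@multilinear F n `&` @polyIdent F A) e ->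
  codim A n = k.
Proof. exact/quot_dim_eq/subspace_multilinear_polyIdent. Qed.

End CodimTheory.

Section PIExponents.
Variables (R : realType) (F : fieldType) (A : nonAssocAlgType F).

Definition codim_root (n : nat) : R := (codim A n)%:R `^ n%:R^-1.

(* Extended reals: upper_exp is finite if and only if the codimensions are
   exponentially bounded. *)
Definition lower_exp : \bar R := limn_einf (fun n => (codim_root n)%:E).
Definition upper_exp : \bar R := limn_esup (fun n => (codim_root n)%:E).

End PIExponents.

Definition unital_hull (F : fieldType) (A : nonAssocAlgType F) : Type :=
  (F^o * A)%type.
HB.instance Definition _ (F : fieldType) (A : nonAssocAlgType F) :=
  GRing.Lmodule.copy (unital_hull A) (F^o * A)%type.

Section UnitalHull.
Variables (F : fieldType) (A : nonAssocAlgType F).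
Implicit Types p q : unital_hull A.

Definition hullMul p q : unital_hull A :=
  let: (a, x) := p in let: (b, y) := q in
  (a * b, (a : F) *: y + (b : F) *: x + namul x y).

Lemma hullMulDl : left_distributive hullMul +%R.
Proof.
move=> [a x] [b y] [c z]; congr pair => /=; first exact: mulrDl.
by rewrite scalerDl scalerDr namulDl [RHS]addrACA; congr (_ + _); rewrite addrACA.
Qed.

Lemma hullMulDr : right_distributive hullMul +%R.
Proof.
move=> [a x] [b y] [c z]; congr pair => /=; first exact: mulrDr.
by rewrite scalerDl scalerDr namulDr [RHS]addrACA; congr (_ + _); rewrite addrACA.
Qed.

Lemma hullMulZl a p q : hullMul (a *: p) q = a *: hullMul p q.
Proof.
case: p q => [b x] [c y]; congr pair => /=; first by rewrite -mulrA.
by rewrite namulZl !scalerDr !scalerA (mulrC c).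
Qed.

Lemma hullMulZr a p q : hullMul p (a *: q) = a *: hullMul p q.
Proof.
case: p q => [b x] [c y]; congr pair => /=; first by rewrite mulrCA.
by rewrite namulZr !scalerDr !scalerA (mulrC b).
Qed.

HB.instance Definition _ := Lmodule_isNonAssocAlgebra.Build F (unital_hull A)
  hullMulDl hullMulDr hullMulZl hullMulZr.

End UnitalHull.

(* Main.v *)
Require Import Defs.
From HB Require Import structures.
From mathcomp Require Import all_boot all_order all_algebra finmap.
From mathcomp Require Import all_classical all_reals all_analysis.
From mathcomp Require Import -(notations) monalg.
From mathcomp Require Import zify ring.
Import Order.TTheory GRing.Theory Num.Theory.
Import numFieldNormedType.Exports.
Local Open Scope classical_set_scope.
Local Open Scope ring_scope.

(** The algebra is spanned by letters and by vectors arranged in finite chains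
    (one chain for each [j]).  The only nonzero products are
    vector * letter: in chain [j] the letter at position [s] moves vector [s]
    to vector [s + 1].  That letter is the common letter [0], except at the
    multiples of [T j], where it is a letter used nowhere else in the chain.
    Chain [j] has [N j] vectors.

    Only left-normed monomials survive.  Along a window of [n - 1] positions
    of chain [j], the value of such a monomial depends on its first variable
    and on the variables standing at the marked positions, not on the order of
    the others.  A window that contains [k] marked positions contributes
    therefore about [n ^ (k + 1)] to the codimension.  As long as [n <= T j],
    a window contains at most one mark, and all such chains together
    contribute at most [n ^ 3].  When [n > T j], about [n / T j] marks are
    seen, and [n ^ (n / T j) <= beta ^ n] holds exactly up to
    [n = beta ^ (T j)].  So the chains have length [N j = beta ^ (T j)],
    rounded down: the codimensions never exceed [n ^ 4 * beta ^ n]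
    ([codim_le_beta]) and come close to [beta ^ n] at [n = N j]
    ([codim_ge_beta]).  The next chain has the much larger period
    [T (j + 1) = N j ^ 2], so that at [n = T (j + 1)] the codimension has
    dropped to at most [n ^ 3] ([codim_le_gap]).  Hence the lower exponent is
    [1] and the upper exponent is [beta].

    In the unital hull, a multilinear polynomial may be tested on points whose
    coordinates are [1] or lie in the algebra.  Setting variables to [1]
    deletes them, so the codimension is at most the sum, over the subsets of
    the variables, of the bounds above.  This gives the bound
    [(beta + 1) ^ n], up to a polynomial factor, for all [n].  At
    [n = T (j + 1)] each summand is at most [n ^ 4 * beta ^ (N j)], which is
    subexponential because [N j] is the square root of [n], and the sum has
    [2 ^ n] terms.
    Conversely [2 ^ (n - 1)] is always a lower bound ([codim_hull_ge]): a
    letter annihilates vectors from the left while [1] fixes them from both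
    sides, so the choice of the side on which each variable acts is visible. *)

Set Implicit Arguments.
Unset Strict Implicit.
Unset Printing Implicit Defensive.

(** * Estimating codimensions by functionals and by test points *)

Section CodimensionBounds.
Variable F : fieldType.

Lemma namul0l (A : nonAssocAlgType F) (x : A) : namul 0 x = 0.
Proof. by rewrite -(scale0r 0) namulZl !scale0r. Qed.

Lemma namul0r (A : nonAssocAlgType F) (x : A) : namul x 0 = 0.
Proof. by rewrite -(scale0r 0) namulZr !scale0r. Qed.

Lemma linext_lin (V : lmodType F) (h : naword -> V) k (c : 'I_k -> F)
    (e : 'I_k -> freeNaAlg F) :
  linext h (\sum_i c i *: e i) = \sum_i c i *: linext h (e i).
Proof.
elim/big_rec2: _ => [|i y1 y2 _ <-]; last by rewrite linextD linextZ.
by rewrite -(scale0r 0) linextZ !scale0r.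
Qed.

Lemma subspace_multilinear n : Defs.subspace (@multilinear F n).
Proof.
split=> [w|a f g mf mg w]; first by rewrite msupp0 in_fset0.
move/(fsubsetP (msuppD_le _ _)); rewrite in_fsetU.
by case/orP => [/(fsubsetP (msuppZ_le _ _))/mf|/mg].
Qed.

(** If the common kernel of a list of linear functionals consists of
    identities, the functionals embed the quotient into a space whose
    dimension is the length of the list. *)
Lemma codim_le (A : nonAssocAlgType F) n (J : eqType) (js : seq J)
    (h : J -> naword -> F^o) :
  (forall f, @multilinear F n f ->
     (forall j, j \in js -> linext (h j) f = 0) -> @polyIdent F A f) ->
  (codim A n <= size js)%N.
Proof.
move=> hs; have [e [Pe Fe _]] := codimP A n.
set k := codim A n in e Pe Fe *.
pose M : 'M[F]_(k, size js) :=
  \matrix_(i, j) linext (h (tnth (in_tuple js) j)) (e i).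
rewrite leqNgt; apply/negP => ltsk.
have : kermx M != 0.
  rewrite -mxrank_eq0 mxrank_ker subn_eq0 -ltnNge.
  by rewrite (leq_ltn_trans _ ltsk)// rank_leq_col.
case/rowV0Pn => u /sub_kermxP uM /eqP; apply; apply/rowP => i; rewrite mxE.
have mlu : @multilinear F n (\sum_i u 0 i *: e i).
  exact: subspace_sum (subspace_multilinear n) Pe.
apply: (Fe (u 0)); split=> //; apply: hs => // j /(tnthP (in_tuple js))[x ->].
rewrite linext_lin; move/rowP: uM => /(_ x); rewrite !mxE => uMj.
by rewrite -[RHS]uMj; apply: eq_bigr => i' _; rewrite mxE.
Qed.

(** Monomials [w i] are independent modulo the identities as soon as their
    values at suitable points [phi i], read off by a linear form [pi], make
    up a triangular matrix with nonzero diagonal; [r] is the rank function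
    that orders rows and columns. *)
Lemma codim_ge (A : nonAssocAlgType F) n (I : finType) (D : {set I})
    (w : I -> naword) (phi : I -> nat -> A) (r : I -> nat)
    (pi : A -> F^o) :
  (forall a x y, pi (a *: x + y) = a *: pi x + pi y) ->
  (forall i, i \in D -> perm_eq (navars (w i)) (iota 1 n)) ->
  (forall i, i \in D -> pi (naword_eval (phi i) (w i)) != 0) ->
  (forall i i', i \in D -> i' \in D -> pi (naword_eval (phi i) (w i')) != 0 ->
     i' = i \/ (r i < r i')%N) ->
  (#|D| <= codim A n)%N.
Proof.
move=> pi_lin wn diag tri; have [b bB] := codimP A n.
pose e (i : 'I_#|D|) : freeNaAlg F := mkmalgU (w (enum_val i)) 1.
apply: (quot_free_le (e := e) (subspace_multilinear_polyIdent A n) _ _ bB).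
  move=> i w0 /(fsubsetP (msuppU_le)); rewrite in_fset1 => /eqP ->.
  exact/wn/enum_valP.
have pi0 : pi 0 = 0.
  have := pi_lin 1 0 0; rewrite !scale1r !addr0 -[LHS]addr0.
  by move/addrI.
have pi_sum k (c : 'I_k -> F) (x : 'I_k -> A) :
    pi (\sum_i c i *: x i) = \sum_i c i *: pi (x i).
  by elim/big_rec2: _ => // i y1 y2 _ <-; exact: pi_lin.
move=> c [_ Wc].
have {}Wc (i : 'I_#|D|) :
    \sum_i' c i' *: pi (naword_eval (phi (enum_val i)) (w (enum_val i'))) = 0.
  have := Wc (phi (enum_val i)); rewrite /naeval linext_lin => /(congr1 pi).
  rewrite pi0 pi_sum => {2}<-; apply: eq_bigr => i' _.
  by rewrite linextU.
(* Induction on the distance of the rank from an upper bound: the row of the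
   point [phi i] involves, apart from [c i], only coefficients of higher
   rank. *)
pose m := (\sum_(i < #|D|) r (enum_val i))%N.
have rm (i : 'I_#|D|) : (r (enum_val i) <= m)%N.
  by rewrite /m (bigD1 i)//= leq_addr.
suff H d (i : 'I_#|D|) : (m - r (enum_val i) < d)%N -> c i = 0.
  by move=> i; exact: (H _.+1).
elim: d i => // d IH i lt_d.
move: (Wc i); rewrite (bigD1 i)//= big1 => [|i' i'i].
  rewrite addr0 => /eqP.
  by rewrite scaler_eq0 (negPf (diag _ (enum_valP i))) orbF => /eqP.
set v := pi _; have [->|nz] := eqVneq v 0; first by rewrite scaler0.
case: (tri _ _ (enum_valP i) (enum_valP i') nz) => [/enum_val_inj|lt_r].
  by move=> E; rewrite E eqxx in i'i.
rewrite IH ?scale0r//.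
have := rm i'; have := rm i; move: lt_d lt_r; lia.
Qed.

Lemma codim_mono (A B : nonAssocAlgType F) n :
  @polyIdent F B `<=` @polyIdent F A -> (codim A n <= codim B n)%N.
Proof.
move=> sBA; have [e [Pe Fe _]] := codimP A n; have [b bB] := codimP B n.
apply: quot_free_le (subspace_multilinear_polyIdent B n) Pe _ bB.
by move=> c [mc Wc]; apply: Fe; split=> //; exact: sBA.
Qed.

(** A linear combination of values [h w] that depend only on [g w] vanishes
    when the coefficients sum to zero over each fiber of [g].  This turns
    finitely many functionals, one for each fiber, into a proof that a
    polynomial vanishes at a point. *)
Lemma sum_fiber_eq0 (G : eqType) (V : lmodType F) (s : seq naword)
    (c : naword -> F) (h : naword -> V) (g : naword -> G) :
  (forall w w', w \in s -> w' \in s -> g w = g w' -> h w = h w') ->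
  (forall w, w \in s -> h w = 0 \/ \sum_(w' <- s | g w' == g w) c w' = 0) ->
  \sum_(w <- s) c w *: h w = 0.
Proof.
have [d] := ubnP (size s).
elim: d s => // d IH [|w0 s]; first by rewrite big_nil.
set s0 := w0 :: s => lt_d hg h0.
rewrite (bigID (fun w => g w == g w0)) /=.
rewrite [X in X + _](_ : _ = 0) ?add0r.
  rewrite -big_filter; apply: IH.
  - rewrite size_filter /= eqxx /= add0n.
    by apply: leq_ltn_trans (count_size _ _) _; exact: lt_d.
  - by move=> w w'; rewrite !mem_filter => /andP[_ ws] /andP[_ w's]; exact: hg.
  - move=> w; rewrite mem_filter => /andP[gw ws].
    case: (h0 w ws) => [|h0w]; [by left|right].
    rewrite -[RHS]h0w big_filter_cond; apply: eq_bigl => w'.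
    by case: (g w' =P g w) => [->|]; rewrite ?andbT ?andbF// gw.
rewrite big_seq_cond (eq_bigr (fun w => c w *: h w0)).
  rewrite -big_seq_cond -scaler_suml.
  by case: (h0 w0 (mem_head _ _)) => ->; rewrite ?scaler0 ?scale0r.
move=> w /andP[ws /eqP gw]; congr (_ *: _).
exact: hg (mem_head _ _) _.
Qed.

Lemma linext_indicator (P : pred naword) (f : freeNaAlg F) :
  linext (V := F^o) (fun w => (P w)%:R) f =
  \sum_(w <- msupp f | P w) mcoeff w f.
Proof.
rewrite /linext [RHS]big_mkcond; apply: eq_bigr => w _.
by case: (P w); [exact: mulr1|exact: mulr0].
Qed.

End CodimensionBounds.

(** * The chain algebra *)

(** Letters and vectors are arbitrary functions, not only finitely supported
    ones: products are computed coordinate by coordinate, so that the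
    identities are the same. *)
Definition chainAlg (F : fieldType) (T N : nat -> nat) : Type :=
  ((nat -> F^o) * (nat -> nat -> F^o))%type.
HB.instance Definition _ (F : fieldType) (T N : nat -> nat) :=
  GRing.Lmodule.copy (chainAlg F T N)
    ((nat -> F^o) * (nat -> nat -> F^o))%type.

Definition letter d s := if (d %| s)%N then s.+1 else 0%N.

Section ChainAlgebra.
Variables (F : fieldType) (T N : nat -> nat).
Local Notation A := (chainAlg F T N).

Definition chainMul (x y : A) : A :=
  (0, fun j s => if s is s'.+1 then
    if (s'.+1 < N j)%N then x.2 j s' * y.1 (letter (T j) s') else 0 else 0).

Lemma chainMulDl : left_distributive chainMul +%R.
Proof.
move=> x y z; congr pair; first by rewrite /= addr0.
apply/funext => j; apply/funext => s.
transitivity ((chainMul x z).2 j s + (chainMul y z).2 j s) => //.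
by case: s => [|s] /=; rewrite ?addr0//; case: ifP; rewrite ?addr0// -mulrDl.
Qed.

Lemma chainMulDr : right_distributive chainMul +%R.
Proof.
move=> x y z; congr pair; first by rewrite /= addr0.
apply/funext => j; apply/funext => s.
transitivity ((chainMul x y).2 j s + (chainMul x z).2 j s) => //.
by case: s => [|s] /=; rewrite ?addr0//; case: ifP; rewrite ?addr0// -mulrDr.
Qed.

Lemma chainMulZl a x y : chainMul (a *: x) y = a *: chainMul x y :> A.
Proof.
congr pair; first by rewrite /= scaler0.
apply/funext => j; apply/funext => s.
transitivity (a * (chainMul x y).2 j s) => //.
by case: s => [|s] /=; rewrite ?mulr0//; case: ifP; rewrite ?mulr0// mulrA.
Qed.

Lemma chainMulZr a x y : chainMul x (a *: y) = a *: chainMul x y.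
Proof.
congr pair; first by rewrite /= scaler0.
apply/funext => j; apply/funext => s.
transitivity (a * (chainMul x y).2 j s) => //.
by case: s => [|s] /=; rewrite ?mulr0//; case: ifP; rewrite ?mulr0// mulrCA.
Qed.

HB.instance Definition _ := Lmodule_isNonAssocAlgebra.Build F (chainAlg F T N)
  chainMulDl chainMulDr chainMulZl chainMulZr.

Lemma chain_linear2 a (x y : A) j s :
  (a *: x + y).2 j s = a *: (x.2 j s : F^o) + y.2 j s.
Proof. by []. Qed.

Lemma chain_eq0 (x : A) : x.1 = 0 -> (forall j s, x.2 j s = 0) -> x = 0.
Proof.
case: x => l z /= -> z0; congr pair.
by apply/funext => j; apply/funext => s; rewrite z0.
Qed.

Fixpoint left_normed w :=
  match w with
  | NaVar _ => true
  | NaMul u (NaVar _) => left_normed u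
  | NaMul _ _ => false
  end.

Definition comb (x0 : nat) (xs : seq nat) :=
  foldl (fun u i => NaMul u (NaVar i)) (NaVar x0) xs.

Lemma comb_rcons x0 xs i : comb x0 (rcons xs i) = NaMul (comb x0 xs) (NaVar i).
Proof. exact: foldl_rcons. Qed.

Lemma navars_comb x0 xs : navars (comb x0 xs) = x0 :: xs.
Proof.
elim/last_ind: xs => // xs i IH.
by rewrite comb_rcons /= IH -rcons_cons cats1.
Qed.

Lemma left_normed_comb x0 xs : left_normed (comb x0 xs).
Proof. by elim/last_ind: xs => // xs i IH; rewrite comb_rcons. Qed.

Lemma left_normedP w : left_normed w -> exists x0 xs, w = comb x0 xs.
Proof.
elim: w => [i _|u IHu [i _|//]]; first by exists i, [::].
by move=> /= /IHu [x0 [xs ->]]; exists x0, (rcons xs i); rewrite comb_rcons.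
Qed.

Lemma navars_gt0 w : (0 < size (navars w))%N.
Proof. by elim: w => //= u IHu v _; rewrite size_cat addn_gt0 IHu. Qed.

Lemma chain_mul_letterless (x y : A) : y.1 = 0 -> namul x y = 0.
Proof.
move=> y0; congr pair; apply/funext => j; apply/funext => -[|s] //.
by rewrite y0; case: ifP => // _; exact: mulr0.
Qed.

(** A product has no letter component, hence annihilates everything when it
    acts from the right. *)
Lemma eval_not_left_normed (phi : nat -> A) w :
  ~~ left_normed w -> naword_eval phi w = 0.
Proof.
elim: w => // u IHu [i _ /= /IHu -> |v1 v2 _ _]; first exact: namul0l.
exact: chain_mul_letterless.
Qed.

Lemma eval_comb (phi : nat -> A) x0 xs j q : (q + size xs < N j)%N ->
  (naword_eval phi (comb x0 xs)).2 j (q + size xs)%N =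
  (phi x0).2 j q *
  \prod_(p <- zip xs (iota q (size xs))) (phi p.1).1 (letter (T j) p.2).
Proof.
elim/last_ind: xs => [|xs i IH]; first by rewrite addn0 big_nil mulr1.
rewrite comb_rcons size_rcons addnS -[in iota _ _]addn1 iotaD => lt_N.
rewrite /= lt_N IH; last exact: ltnW.
rewrite cats1 zip_rcons ?size_iota// -cats1 big_cat.
by rewrite big_seq1 mulrA.
Qed.

Lemma eval_comb_out (phi : nat -> A) x0 xs j s : xs != [::] ->
  (s < size xs)%N || (N j <= s)%N -> (naword_eval phi (comb x0 xs)).2 j s = 0.
Proof.
elim/last_ind: xs s => // xs i IH [|s]; rewrite comb_rcons //= size_rcons => _.
case: ifP => // lt_N /orP[lts|]; last by rewrite leqNgt lt_N.
move: lts; rewrite ltnS => lts.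
rewrite IH ?mul0r ?lts// -size_eq0 -lt0n.
exact: leq_ltn_trans lts.
Qed.

End ChainAlgebra.

(** * Signatures of monomials *)

Lemma prod_zip_mask (R : comPzRingType) (F : nat -> nat -> R) (G : nat -> R)
    (P : pred nat) xs ts : size xs = size ts ->
  (forall x t, ~~ P t -> F x t = G x) ->
  \prod_(q <- zip xs ts) F q.1 q.2 =
  (\prod_(q <- zip (mask (map P ts) xs) (mask (map P ts) ts)) F q.1 q.2) *
  \prod_(x <- mask (map (predC P) ts) xs) G x.
Proof.
move=> + FG; elim: xs ts => [|x xs IH] [|t ts] //= => [_|[sz]].
  by rewrite !big_nil mulr1.
rewrite big_cons IH//; case: (boolP (P t)) => Pt /=.
  by rewrite big_cons mulrA.
by rewrite big_cons FG//; exact: mulrCA.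
Qed.

Lemma perm_mask_predC (P : pred nat) (xs ts : seq nat) : size xs = size ts ->
  perm_eq (mask (map P ts) xs ++ mask (map (predC P) ts) xs) xs.
Proof.
elim: xs ts => [|x xs IH] [|t ts] //= [sz].
case: (P t) => /=; first by rewrite perm_cons IH.
by rewrite -cat1s perm_catCA perm_cons IH.
Qed.

(** What the value of a left-normed monomial along a window depends on: its
    first variable and the variables at the marked positions, which the mask
    [p] selects.  The empty sequence stands for the other monomials. *)
Definition signature p w : seq nat :=
  if left_normed w then head 0%N (navars w) :: mask p (behead (navars w))
  else [::].

Lemma eval_signature (F : fieldType) (T N : nat -> nat)
    (phi : nat -> chainAlg F T N) w w' j q (m := (size (navars w)).-1) :
  perm_eq (navars w) (navars w') -> (q + m < N j)%N ->
  (let p := [seq (T j %| t)%N | t <- iota q m] in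
   signature p w = signature p w') ->
  (naword_eval phi w).2 j (q + m)%N = (naword_eval phi w').2 j (q + m)%N.
Proof.
rewrite {}/m /signature.
case: (boolP (left_normed w)); case: (boolP (left_normed w')) => //; first last.
  by move=> /eval_not_left_normed -> /eval_not_left_normed ->.
move=> /left_normedP[x0' [xs' ->]] /left_normedP[x0 [xs ->]].
rewrite !navars_comb /= => pxx lt_N [ex0 em]; subst x0'.
have pxs : perm_eq xs xs' by move: pxx; rewrite perm_cons.
have sz := perm_size pxs.
rewrite eval_comb// [in RHS]sz eval_comb -?sz//; congr (_ * _).
pose Fx x t := (phi x).1 (letter (T j) t); pose G x := (phi x).1 0%N.
have FG x t : ~~ (T j %| t)%N -> Fx x t = G x.
  by rewrite /Fx /letter => /negPf ->.
have sz' := size_iota q (size xs).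
have step zs : size zs = size xs ->
    \prod_(p <- zip zs (iota q (size xs))) (phi p.1).1 (letter (T j) p.2) = _ :=
  fun szz => prod_zip_mask (etrans szz (esym sz')) FG.
rewrite !step// em; congr (_ * _); apply: perm_big.
rewrite -(perm_cat2l (mask [seq (T j %| t)%N | t <- iota q (size xs)] xs)).
rewrite (permPl (perm_mask_predC _ _)) ?size_iota// em.
by rewrite perm_sym (permPl (perm_mask_predC _ _)) ?size_iota// perm_sym.
Qed.

Fixpoint words_over (vs : seq nat) (k : nat) : seq (seq nat) :=
  if k is k'.+1 then [seq x :: g | x <- vs, g <- words_over vs k']
  else [:: [::]].

Lemma size_words_over vs k : size (words_over vs k) = (size vs ^ k)%N.
Proof. by elim: k => //= k IH; rewrite size_allpairs IH expnS. Qed.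

Lemma mem_words_over vs g : {subset g <= vs} -> g \in words_over vs (size g).
Proof.
elim: g => [|x g IH] //= sub; apply: allpairs_f; first exact/sub/mem_head.
by apply: IH => y yg; apply: sub; rewrite inE yg orbT.
Qed.

(** A finite list that covers all windows of length [m], although there are
    infinitely many chains: a period of at least [m] allows at most one mark,
    and a smaller one occurs only for [j < m], with finitely many phases. *)
Definition patterns (T N : nat -> nat) m : seq bitseq :=
  nseq m false :: [seq [seq t == t0 | t <- iota 0 m] | t0 <- iota 0 m] ++
  [seq [seq (T j %| r + t)%N | t <- iota 0 m]
     | j <- [seq j <- iota 0 m | (T j < m)%N && (m < N j)%N], r <- iota 0 m].

Lemma size_pattern T N p m : p \in patterns T N m -> size p = m.
Proof.
rewrite inE mem_cat => /orP[/eqP->|/orP[/mapP[t0 _ ->]|]].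
- by rewrite size_nseq.
- by rewrite size_map size_iota.
- by case/allpairsP=> -[j r] [_ _ ->]; rewrite size_map size_iota.
Qed.

Lemma window_pattern (T N : nat -> nat) j q m :
  (forall i, i < T i)%N -> (q + m < N j)%N ->
  [seq (T j %| t)%N | t <- iota q m] \in patterns T N m.
Proof.
move=> /(_ j) jT lt_N; have T0 : (0 < T j)%N by exact: leq_ltn_trans jT.
rewrite -[q in iota q m]addn0 iotaDl -map_comp inE mem_cat.
have [leT|ltT] := leqP m (T j); last first.
  apply/orP; right; apply/orP; right; apply/allpairsP; exists (j, (q %% T j)%N).
  rewrite mem_filter !mem_iota /= ltT (ltn_trans jT ltT).
  rewrite (leq_ltn_trans _ lt_N) ?leq_addl//.
  split=> //; first by rewrite add0n (ltn_trans _ ltT)// ltn_mod.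
  by apply: eq_map => t /=; rewrite /dvdn modnDml.
case: (boolP (has (fun t => T j %| q + t)%N (iota 0 m))) => [|/hasPn none].
  case/hasP => t0 t0m dt0; apply/orP; right; apply/orP; left.
  apply/mapP; exists t0 => //.
  apply/eq_in_map => t tm /=; apply/idP/eqP => [dt|->//].
  move: t0m tm; rewrite !mem_iota !add0n /= => t0m tm.
  case: (ltngtP t t0) => // ltt; exfalso.
    move: (dvdn_sub dt0 dt); rewrite subnDl => d_sub.
    by have := dvdn_leq _ d_sub; rewrite subn_gt0 => /(_ ltt); lia.
  move: (dvdn_sub dt dt0); rewrite subnDl => d_sub.
  by have := dvdn_leq _ d_sub; rewrite subn_gt0 => /(_ ltt); lia.
apply/orP; left; apply/eqP.
have -> : nseq m false = [seq false | _ <- iota 0 m].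
  by rewrite -[in LHS](size_iota 0 m); elim: (iota 0 m) => //= _ s <-.
by apply/eq_in_map => t /none /= /negPf.
Qed.

Lemma signature_in p w (vs : seq nat) :
  perm_eq (navars w) vs -> size p = (size vs).-1 -> left_normed w ->
  signature p w \in words_over vs (count id p).+1.
Proof.
move=> pw szp /left_normedP[x0 [xs E]]; move: pw; rewrite /signature {w}E.
rewrite left_normed_comb navars_comb /= => pw.
have szm : size (mask p xs) = count id p.
  by rewrite size_mask// szp -(perm_size pw).
rewrite -szm -/(size (x0 :: mask p xs)); apply: mem_words_over => y yg.
rewrite -(perm_mem pw); move: yg; rewrite !inE => /orP[->//|/mem_mask ->].
by rewrite orbT.
Qed.

Section Vanishing.
Variables (F : fieldType) (T N : nat -> nat).
Hypothesis T_gt : forall i, (i < T i)%N.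
Local Notation A := (chainAlg F T N).

Lemma sum_chain2 (ws : seq naword) c (x : naword -> A) j s :
  (\sum_(w <- ws) c w *: x w).2 j s = \sum_(w <- ws) c w *: ((x w).2 j s : F^o).
Proof. by elim: ws => [|w ws IH]; rewrite ?big_nil// !big_cons -IH. Qed.

Lemma sum_chain1 (ws : seq naword) c (x : naword -> A) :
  (\sum_(w <- ws) c w *: x w).1 = \sum_(w <- ws) c w *: (x w).1.
Proof. by elim: ws => [|w ws IH]; rewrite ?big_nil// !big_cons -IH. Qed.

(** Each coordinate of the value sees one window, hence one pattern, and the
    sums over its signatures suffice for that coordinate.  The map [d] is
    there for the unital hull, where monomials lose some of their variables
    before they are evaluated. *)
Lemma chain_vanish (ws : seq naword) (c : naword -> F) (d : naword -> naword)
    (vs : seq nat) :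
  (forall w, w \in ws -> perm_eq (navars (d w)) vs) ->
  (forall p g, p \in patterns T N (size vs).-1 ->
     g \in words_over vs (count id p).+1 ->
     \sum_(w <- ws | signature p (d w) == g) c w = 0) ->
  forall phi : nat -> A, \sum_(w <- ws) c w *: naword_eval phi (d w) = 0.
Proof.
move=> dvs sig0 phi.
have sum0 p : p \in patterns T N (size vs).-1 -> forall w, w \in ws ->
    naword_eval phi (d w) = 0 \/
    \sum_(w' <- ws | signature p (d w') == signature p (d w)) c w' = 0.
  move=> pP w ww.
  have [ln|/eval_not_left_normed ->] := boolP (left_normed (d w)); last by left.
  right; apply: (sig0 p) => //.
  by apply: signature_in => //; [exact: dvs|exact: size_pattern pP].
have [sz1|sz1] := leqP (size vs) 1%N.
  apply: (sum_fiber_eq0 (g := fun w => signature [::] (d w))); last first.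
    by apply: sum0; rewrite -subn1 (eqP (sz1 : (size vs - 1 == 0)%N)) inE.
  move=> w w' /dvs pw /dvs pw'.
  have var v : perm_eq (navars v) vs -> exists i, v = NaVar i.
    move=> /perm_size; case: v => [i _|v1 v2 /=]; first by exists i.
    rewrite size_cat => E; have := leq_add (navars_gt0 v1) (navars_gt0 v2).
    by rewrite E addn1 ltnNge sz1.
  by have [[i ->] [i' ->]] := (var _ pw, var _ pw') => -[->].
have mulw w : w \in ws -> exists u v, d w = NaMul u v.
  move=> /dvs /perm_size; case: (d w) => [i /= sz|u v _]; last by exists u, v.
  by rewrite -sz in sz1.
apply: chain_eq0 => [|j s].
  rewrite sum_chain1 big_seq big1// => w /mulw[u [v ->]] /=; exact: scaler0.
rewrite sum_chain2; set m := (size vs).-1.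
have [win|out] := boolP ((m <= s)%N && (s < N j)%N); last first.
  rewrite big_seq big1// => w ww.
  suff -> : (naword_eval phi (d w)).2 j s = 0 by exact: scaler0.
  have [|/eval_not_left_normed ->//] := boolP (left_normed (d w)).
  move=> /left_normedP[x0 [xs E]].
  move: (perm_size (dvs w ww)); rewrite E navars_comb /= => sz.
  apply: eval_comb_out.
    by rewrite -size_eq0 -lt0n; move: sz1; rewrite -sz.
  by move: out; rewrite negb_and -ltnNge -leqNgt /m -sz.
have /andP[ms sN] := win; rewrite -(subnK ms) in sN *.
have pP := window_pattern T_gt sN.
apply: (sum_fiber_eq0 (V := F^o)
  (h := fun w => (naword_eval phi (d w)).2 j (s - m + m)%N)
  (g := fun w => signature [seq (T j %| t)%N | t <- iota (s - m) m] (d w))).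
  move=> w w' ww ww' sg; have [pw pw'] := (dvs _ ww, dvs _ ww').
  have szw : (size (navars (d w))).-1 = m by rewrite (perm_size pw).
  have := @eval_signature F T N phi (d w) (d w') j (s - m)%N.
  by rewrite szw; apply => //; rewrite (permPl pw) perm_sym.
by move=> w ww; case: (sum0 _ pP w ww) => [->|]; [left|right].
Qed.

End Vanishing.

(** * Unital hulls and the deletion of variables *)

Section Multilinearity.
Variables (F : fieldType) (A : nonAssocAlgType F).

Definition update (phi : nat -> A) i x : nat -> A :=
  fun k => if k == i then x else phi k.

Lemma eq_naword_eval (phi psi : nat -> A) w : {in navars w, phi =1 psi} ->
  naword_eval phi w = naword_eval psi w.
Proof.
elim: w => [i|u IHu v IHv] /= eq_phi; first exact/eq_phi/mem_head.
by rewrite IHu ?IHv// => i iw; apply: eq_phi; rewrite mem_cat iw ?orbT.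
Qed.

Lemma update_out (phi : nat -> A) i x w : i \notin navars w ->
  naword_eval (update phi i x) w = naword_eval phi w.
Proof.
move=> iw; apply: eq_naword_eval => k kw; rewrite /update.
by case: eqP kw iw => // -> ->.
Qed.

Lemma naword_eval_linear (phi : nat -> A) i a x y w :
  uniq (navars w) -> i \in navars w ->
  naword_eval (update phi i (a *: x + y)) w =
  a *: naword_eval (update phi i x) w + naword_eval (update phi i y) w.
Proof.
elim: w => [k _|u IHu v IHv] /=.
  by rewrite inE /update => /eqP ->; rewrite eqxx.
rewrite cat_uniq mem_cat => /and3P[uu /hasPn dis uv] /orP[iu|iv].
  have iv : i \notin navars v by apply: contraL iu; exact: dis.
  by rewrite IHu// !(update_out _ _ iv) namulDl namulZl.
by rewrite IHv// !(update_out _ _ (dis _ iv)) namulDr namulZr.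
Qed.

(** The variables are replaced one after the other by elements of [G]. *)
Lemma polyIdent_generators n (G : set A) (f : freeNaAlg F) :
  (forall x, exists a g1 g2, [/\ G g1, G g2 & x = a *: g1 + g2]) ->
  @multilinear F n f ->
  (forall phi : nat -> A, (forall i, i \in iota 1 n -> G (phi i)) ->
     naeval phi f = 0) ->
  @polyIdent F A f.
Proof.
move=> genG mf f0 phi.
have H : forall (l : seq nat) (phi : nat -> A),
    (forall i, i \in iota 1 n -> i \notin l -> G (phi i)) -> naeval phi f = 0.
  elim=> [|i l IH] {}phi Gphi; first by apply: f0 => i i1; exact: Gphi.
  have [iin|iout] := boolP (i \in iota 1 n); last first.
    apply: IH => k k1 kl; apply: Gphi => //; rewrite inE negb_or kl andbT.
    by apply: contraNneq iout => <-.
  have [a [g1 [g2 [G1 G2 phiE]]]] := genG (phi i).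
  have upd0 g : G g -> naeval (update phi i g) f = 0.
    move=> Gg; apply: IH => k k1 kl; rewrite /update.
    case: eqP => // /eqP ki.
    by apply: Gphi => //; rewrite inE negb_or ki.
  have -> : naeval phi f =
      a *: naeval (update phi i g1) f + naeval (update phi i g2) f.
    rewrite /naeval -linext_scale -linext_sum; apply: eq_big_seq => w /mf pw.
    congr (_ *: _); rewrite -naword_eval_linear.
    - apply: eq_naword_eval => k _; rewrite /update -phiE.
      by case: eqP => [->|].
    - by rewrite (perm_uniq pw) iota_uniq.
    - by rewrite (perm_mem pw).
  by rewrite !upd0// scaler0 addr0.
by apply: (H (iota 1 n)) => i ->.
Qed.

End Multilinearity.

Fixpoint keep_vars (b : pred nat) w : option naword :=
  match w with
  | NaVar i => if b i then Some w else None
  | NaMul u v =>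
      match keep_vars b u, keep_vars b v with
      | Some u', Some v' => Some (NaMul u' v')
      | Some u', None => Some u'
      | None, o => o
      end
  end.

Lemma navars_keep_vars b w :
  oapp navars [::] (keep_vars b w) = [seq i <- navars w | b i].
Proof.
elim: w => [i|u IHu v IHv] /=; first by case: (b i).
rewrite filter_cat -IHu -IHv.
by case: (keep_vars b u) => [u'|]; case: (keep_vars b v) => //=; rewrite cats0.
Qed.

Section Hull.
Variables (F : fieldType) (A : nonAssocAlgType F).
Implicit Types p q x : unital_hull A.

Lemma hull_linear2 a x y : (a *: x + y).2 = a *: (x.2 : A) + y.2.
Proof. by []. Qed.

Lemma hull_mulE p q :
  namul p q = (p.1 * q.1, (p.1 : F) *: q.2 + (q.1 : F) *: p.2 + namul p.2 q.2).
Proof. by case: p q => [a x] [b y]. Qed.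

Lemma hull_mul1r x : namul x ((1, 0) : unital_hull A) = x.
Proof.
case: x => l x.
by rewrite hull_mulE /= mulr1 namul0r scaler0 scale1r add0r addr0.
Qed.

Lemma hull_mul1l x : namul ((1, 0) : unital_hull A) x = x.
Proof.
by case: x => l x; rewrite hull_mulE /= mul1r namul0l scaler0 scale1r !addr0.
Qed.

Lemma hull_mul_inj (x y : A) :
  namul ((0, x) : unital_hull A) (0, y) = (0, namul x y).
Proof. by rewrite hull_mulE /= mulr0 !scale0r !add0r. Qed.

Lemma eval_hull (phi : nat -> unital_hull A) (y : nat -> A) b w :
  (forall i, i \in navars w -> phi i = if b i then (0, y i) else (1, 0)) ->
  naword_eval phi w =
  if keep_vars b w is Some u then (0, naword_eval y u) else (1, 0).
Proof.
elim: w => [i|u IHu v IHv] /= phiE.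
  by rewrite phiE ?mem_head//; case: (b i).
rewrite IHu => [|i iu]; last by rewrite phiE// mem_cat iu.
rewrite IHv => [|i iv]; last by rewrite phiE// mem_cat iv orbT.
case: (keep_vars b u) => [u'|]; last by rewrite hull_mul1l.
by case: (keep_vars b v) => [v'|]; rewrite ?hull_mul_inj ?hull_mul1r.
Qed.

Lemma codim_le_hull n : (codim A n <= codim (unital_hull A) n)%N.
Proof.
apply: codim_mono => f If phi.
have := If (fun i => (0, phi i)); rewrite /naeval /linext.
have -> : forall s,
    \sum_(w <- s) mcoeff w f *:
      naword_eval (fun i => (0, phi i) : unital_hull A) w =
    (0, \sum_(w <- s) mcoeff w f *: naword_eval phi w).
  move=> s; elim: s => [|w s IH]; rewrite ?big_nil ?big_cons//.
  rewrite IH (@eval_hull _ phi predT) => [|//].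
  have -> : keep_vars predT w = Some w by elim: (w) => //= u -> v ->.
  by congr pair; rewrite /= ?addr0//; exact: mulr0.
by case.
Qed.

End Hull.

(** * Upper bounds for the codimensions *)

Definition signatures T N (vs : seq nat) : seq (bitseq * seq nat) :=
  [seq (p, g) | p <- patterns T N (size vs).-1,
                g <- words_over vs (count id p).+1].

Definition num_signatures T N n : nat :=
  (\sum_(p <- patterns T N n.-1) n ^ (count id p).+1)%N.

Lemma size_signatures T N vs :
  size (signatures T N vs) = num_signatures T N (size vs).
Proof.
rewrite size_allpairs_dep sumnE big_map; apply: eq_bigr => p _.
exact: size_words_over.
Qed.

Fixpoint sublists (s : seq nat) : seq (seq nat) :=
  if s is x :: s' then map (cons x) (sublists s') ++ sublists s' else [:: [::]].

Lemma filter_sublists (b : pred nat) s : [seq x <- s | b x] \in sublists s.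
Proof.
elim: s => //= x s IH; rewrite mem_cat; case: ifP => _; last by rewrite IH orbT.
by rewrite map_f.
Qed.

Lemma sum_sublists_expr (R : comPzRingType) (b : R) s :
  \sum_(vs <- sublists s) b ^+ size vs = (b + 1) ^+ size s.
Proof.
elim: s => [|x s IH]; first by rewrite big_seq1 expr0.
rewrite big_cat big_map exprS mulrDl mul1r -IH mulr_sumr.
by congr (_ + _); apply: eq_bigr => vs _; rewrite exprS.
Qed.

Lemma size_sublists s : size (sublists s) = (2 ^ size s)%N.
Proof.
by elim: s => //= x s IH; rewrite size_cat size_map IH addnn expnS mul2n.
Qed.

Lemma size_mem_sublists s vs : vs \in sublists s -> (size vs <= size s)%N.
Proof.
elim: s vs => [|x s IH] vs /=; first by rewrite inE => /eqP->.
rewrite mem_cat => /orP[/mapP[us /IH us_s ->]//|/IH]; exact: leqW.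
Qed.

Section UpperBounds.
Variables (F : fieldType) (T N : nat -> nat).
Hypothesis T_gt : forall i, (i < T i)%N.
Local Notation A := (chainAlg F T N).

Lemma codim_chain_le n : (codim A n <= num_signatures T N n)%N.
Proof.
rewrite -{2}(size_iota 1 n) -size_signatures.
apply: (codim_le (h := fun pg w => (signature pg.1 w == pg.2)%:R)).
move=> f mf f0 phi.
apply: (chain_vanish (d := id) T_gt) mf _ phi => p g pP gP.
rewrite -[RHS](f0 (p, g)); first by rewrite linext_indicator.
exact: allpairs_f_dep.
Qed.

(** By multilinearity it is enough to test points whose coordinates are [1]
    or lie in the chain algebra.  If [vs] lists the variables of the second
    kind, the value is that of the polynomial from which the other variables
    have been deleted.  The functional [None], the sum of the coefficients,
    settles the case where all variables are set to [1]. *)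
Lemma codim_hull_le n :
  (codim (unital_hull A) n <=
    (\sum_(vs <- sublists (iota 1 n)) num_signatures T N (size vs)).+1)%N.
Proof.
pose d (vs : seq nat) w := odflt (NaVar 0) (keep_vars (mem vs) w).
pose js := None :: map Some
  [seq (vs, pg) | vs <- sublists (iota 1 n), pg <- signatures T N vs].
set bound := (bound in (_ <= bound)%N); have -> : bound = size js.
  rewrite /bound /= size_map size_allpairs_dep sumnE big_map; congr _.+1.
  by apply: eq_bigr => vs _; rewrite size_signatures.
apply: (codim_le (h := fun j w => if j is Some (vs, (p, g))
    then (signature p (d vs w) == g)%:R else 1)) => f mf f0.
pose G : set (unital_hull A) := [set x | x = (1, 0) \/ x.1 = 0].
apply: (polyIdent_generators (G := G) _ (mf)).
  move=> [l x]; exists l, (1, 0), (0, x); split; [by left|by right|].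
  by congr pair; rewrite /= ?addr0 ?scaler0 ?add0r//; exact/esym/mulr1.
move=> phi Gphi; pose vs := [seq i <- iota 1 n | (phi i).1 == 0].
pose y i : A := (phi i).2.
have phiE i : i \in iota 1 n -> phi i = if i \in vs then (0, y i) else (1, 0).
  move=> i1; rewrite mem_filter i1 andbT /y.
  case: (Gphi i i1) => [->|]; first by rewrite /= oner_eq0.
  by case: (phi i) => l x /= ->; rewrite eqxx.
have evalE w : w \in msupp f -> naword_eval phi w =
    if keep_vars (mem vs) w is Some u then (0, naword_eval y u) else (1, 0).
  by move=> /mf pw; apply: eval_hull => i; rewrite (perm_mem pw) => /phiE.
have navE w : w \in msupp f ->
    perm_eq (oapp navars [::] (keep_vars (mem vs) w)) vs.
  move=> /mf pw; rewrite navars_keep_vars (permPl (perm_filter _ pw)).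
  rewrite [X in perm_eq X](_ : _ = vs)//; apply: eq_in_filter => i i1.
  by rewrite /= mem_filter i1 andbT.
have [vs0|vs0] := eqVneq vs [::].
  rewrite /naeval /linext (eq_big_seq (fun w => mcoeff w f *: (1, 0))).
    rewrite -scaler_suml.
    have sum0 : \sum_(w <- msupp f) mcoeff w f = 0.
      rewrite -[RHS](f0 None (mem_head _ _)); apply: eq_bigr => w _.
      exact/esym/mulr1.
    by rewrite sum0 scale0r.
  move=> w wf; rewrite evalE//; have := navE w wf; rewrite vs0.
  case: (keep_vars _ w) => // u /perm_size /= sz.
  by have := navars_gt0 u; rewrite sz.
have keepE w : w \in msupp f -> keep_vars (mem vs) w = Some (d vs w).
  move=> wf; rewrite /d; have := navE w wf.
  case: (keep_vars _ w) => // /perm_size /esym /size0nil vs0'.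
  by rewrite vs0' eqxx in vs0.
pose z w : unital_hull A := (0, mcoeff w f *: naword_eval y (d vs w)).
rewrite /naeval /linext (eq_big_seq z); last first.
  move=> w wf; rewrite evalE// keepE//.
  by congr pair; exact: scaler0.
have zE (s : seq naword) :
    \sum_(w <- s) z w = (0, \sum_(w <- s) mcoeff w f *: naword_eval y (d vs w)).
  elim: s => [|w s IH]; rewrite ?big_nil ?big_cons//.
  by rewrite IH; congr pair; exact: addr0.
rewrite zE; congr pair; apply: (chain_vanish (d := d vs) (vs := vs) T_gt).
  by move=> w wf; have := navE w wf; rewrite keepE.
move=> p g pP gP; rewrite -[RHS](f0 (Some (vs, (p, g)))).
  by rewrite linext_indicator.
rewrite inE map_f//; apply: allpairs_f_dep; first exact: filter_sublists.
exact: allpairs_f_dep.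
Qed.

End UpperBounds.

(** Summing the indicator over a window of length [m] telescopes: the left
    side counts the multiples in the window plus those before it. *)
Lemma count_multiples d r m : (0 < d)%N ->
  (count (fun t => d %| r + t)%N (iota 0 m) + (r + d).-1 %/ d =
   (r + m + d).-1 %/ d)%N.
Proof.
move=> d0; elim: m => [|m IH]; first by rewrite addn0.
rewrite -addn1 iotaD count_cat /= addn0 add0n addnAC IH.
have -> : ((r + (m + 1) + d).-1 = (r + m + d).-1.+1)%N by move: d0; lia.
rewrite divnS// addnC; congr (_ + _)%N.
by rewrite prednK ?addn_gt0 ?d0 ?orbT// (dvdn_addl _ (dvdnn d)).
Qed.

Lemma count_multiples_le d r m : (0 < d)%N ->
  (count (fun t => d %| r + t)%N (iota 0 m) <= m %/ d + 1)%N.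
Proof.
move=> d0; rewrite -(leq_add2r ((r + d).-1 %/ d)%N) count_multiples//.
have -> : ((r + m + d).-1 = m + (r + d).-1)%N by move: d0; lia.
by rewrite divnD// addnAC leq_add2r leq_add2l leq_b1.
Qed.

Lemma leq_count_multiples d m : (0 < d)%N ->
  (m <= d * count (fun t => d %| t)%N (iota 0 m))%N.
Proof.
move=> d0; have := count_multiples 0 m d0; rewrite !add0n.
rewrite divn_small ?ltn_predL// addn0 => ->.
have := divn_eq (m + d).-1 d; have := ltn_mod (m + d).-1 d; rewrite d0 mulnC.
lia.
Qed.

Lemma size_patterns T N m : (size (patterns T N m) <= m.+1 ^ 2)%N.
Proof.
rewrite /= size_cat size_allpairs !size_map !size_iota size_filter.
have := count_size (fun j => (T j < m) && (m < N j))%N (iota 0 m).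
rewrite size_iota => le_m.
apply: (@leq_trans (m + m * m).+1); last by rewrite expnS expn1; lia.
by rewrite ltnS leq_add2l leq_mul.
Qed.

Lemma count_pattern_le1 m t0 : (count id [seq t == t0 | t <- iota 0 m] <= 1)%N.
Proof.
rewrite count_map; have := count_uniq_mem t0 (iota_uniq 0 m) => /= ->.
exact: leq_b1.
Qed.

(** A window that fits into chain [j] has [n <= N j <= beta ^ (T j)], and
    about [n / T j] marks, whence [n ^ (n / T j) <= beta ^ n]. *)
Lemma num_signatures_le (R : realType) (T N : nat -> nat) (beta : R) n :
  1 <= beta -> (forall j, (0 < T j)%N) ->
  (forall j, (N j)%:R <= beta ^+ T j) ->
  (num_signatures T N n)%:R <= (n ^ 4)%:R * beta ^+ n.
Proof.
move=> beta_ge1 T_gt0 N_le; have beta0 : 0 <= beta by exact: le_trans beta_ge1.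
case: n => [|m].
  by rewrite /num_signatures big1_seq ?exp0n ?mul0r// => p _; rewrite exp0n.
have pat p : p \in patterns T N m ->
    (m.+1 ^ (count id p).+1)%:R <= (m.+1 ^ 2)%:R * beta ^+ m.+1.
  have small : (count id p <= 1)%N ->
      (m.+1 ^ (count id p).+1)%:R <= (m.+1 ^ 2)%:R * beta ^+ m.+1.
    move=> c1; rewrite -[leLHS]mulr1.
    by rewrite ler_pM ?ler0n ?ler01 ?exprn_ege1// ler_nat leq_pexp2l.
  rewrite inE mem_cat => /orP[/eqP pE|/orP[/mapP[t0 _ pE]|]].
  - by apply: small; rewrite pE count_nseq.
  - by apply: small; rewrite pE count_pattern_le1.
  case/allpairsP => -[j r] [/=].
  rewrite mem_filter => /andP[/andP[ltT ltN] _] _ pE.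
  have cp : (count id p <= m %/ T j + 1)%N.
    by rewrite pE count_map count_multiples_le.
  apply: (@le_trans _ _ (m.+1 ^ (2 + m %/ T j))%:R).
    by rewrite ler_nat leq_pexp2l// addnC; move: cp; lia.
  rewrite expnD natrM ler_wpM2l// natrX.
  apply: (@le_trans _ _ ((beta ^+ T j) ^+ (m %/ T j)%N)).
    apply: lerXn2r; rewrite ?nnegrE ?exprn_ge0//.
    by rewrite (le_trans _ (N_le j))// ler_nat.
  rewrite -exprM; apply: ler_weXn2l => //.
  by rewrite mulnC (leq_trans (leq_divM _ _)).
rewrite /num_signatures natr_sum /=.
pose b := (m.+1 ^ 2)%:R * beta ^+ m.+1.
apply: (@le_trans _ _ (\sum_(p <- patterns T N m) b)).
  by rewrite !big_seq; apply: ler_sum => p /pat.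
rewrite big_const_seq count_predT iter_addr_0 -[leLHS]mulr_natl /b mulrA.
rewrite ler_wpM2r ?exprn_ge0// -natrM ler_nat.
by rewrite (expnD _ 2 2) leq_mul// size_patterns.
Qed.

(** Without a chain that is both dense and long enough, only the patterns with
    at most one mark remain. *)
Lemma num_signatures_gap (T N : nat -> nat) n :
  (forall j, ~~ ((T j < n.-1) && (n.-1 < N j))%N) ->
  (num_signatures T N n <= n ^ 3)%N.
Proof.
case: n => [|m] gap.
  by rewrite /num_signatures big1_seq// => p _; rewrite exp0n.
rewrite /num_signatures /patterns /= in gap *.
rewrite (@eq_filter _ _ pred0) ?filter_pred0; last first.
  by move=> j; exact/negbTE.
rewrite cats0 big_cons big_map count_nseq /= mul0n expn1.
apply: (@leq_trans (m.+1 + \sum_(t <- iota 0 m) m.+1 ^ 2)).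
  rewrite leq_add2l leq_sum// => t _.
  by rewrite leq_pexp2l// ltnS count_pattern_le1.
rewrite big_const_seq count_predT size_iota iter_addn_0.
by rewrite !expnS expn0; nia.
Qed.

(** * Lower bounds for the codimensions *)

Lemma leq_exp_ffact m k : ((m - k) ^ k <= m ^_ k)%N.
Proof.
elim: k => // k IH; rewrite ffactnSr expnSr; apply: leq_mul.
  apply: leq_trans IH; case: k => // k.
  by rewrite leq_exp2r// subnS leq_pred.
by rewrite subnS leq_pred.
Qed.

(** The inverse of extracting the subsequences at the marked and at the
    unmarked positions. *)
Fixpoint fill (p : bitseq) (g r : seq nat) : seq nat :=
  match p with
  | [::] => [::]
  | true :: p' => head 0%N g :: fill p' (behead g) r
  | false :: p' => head 0%N r :: fill p' g (behead r)
  end.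

Lemma size_fill p g r : size (fill p g r) = size p.
Proof. by elim: p g r => // -[] p IH g r /=; rewrite IH. Qed.

Lemma mask_fill p g r : size g = count id p -> mask p (fill p g r) = g.
Proof.
elim: p g r => [|[] p IH] [|x g] r //=; rewrite ?add1n ?add0n.
- by case=> sz; rewrite IH.
- by move=> sz; rewrite IH.
- by move=> sz; rewrite IH.
Qed.

Lemma mask_negb_fill p g r : size r = count negb p ->
  mask (map negb p) (fill p g r) = r.
Proof.
elim: p g r => [|[] p IH] g [|x r] //=; rewrite ?add1n ?add0n.
- by move=> sz; rewrite IH.
- by move=> sz; rewrite IH.
- by case=> sz; rewrite IH.
Qed.

Lemma perm_fill p g r : size g = count id p -> size r = count negb p ->
  perm_eq (fill p g r) (g ++ r).
Proof.
elim: p g r => [|[] p IH] g r /=; rewrite ?add1n ?add0n.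
- by move=> /size0nil -> /size0nil ->.
- by case: g => //= x g [szg] szr; rewrite perm_cons IH.
- case: r => //= x r szg [szr].
  by rewrite -[x :: r]cat1s perm_sym perm_catCA /= perm_cons perm_sym IH.
Qed.

(** Choosing for each variable but the first the side from which it multiplies
    gives [2 ^ (n - 1)] words of degree [n], and these turn out to be
    independent in the unital hull. *)
Definition two_sided (K : pred nat) xs : naword :=
  foldl (fun u x => if K x then NaMul u (NaVar x) else NaMul (NaVar x) u)
    (NaVar 1) xs.

Lemma two_sided_rcons K xs x : two_sided K (rcons xs x) =
  if K x then NaMul (two_sided K xs) (NaVar x)
  else NaMul (NaVar x) (two_sided K xs).
Proof. by rewrite /two_sided foldl_rcons. Qed.

Lemma perm_navars_two_sided K xs :
  perm_eq (navars (two_sided K xs)) (1%N :: xs).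
Proof.
elim/last_ind: xs => // xs x IH; rewrite two_sided_rcons.
rewrite -rcons_cons -cats1; case: (K x); rewrite [navars _]/=.
  by rewrite perm_cat2r.
change (perm_eq ([:: x] ++ navars (two_sided K xs)) ((1%N :: xs) ++ [:: x])).
by rewrite perm_catC perm_cat2r.
Qed.

Section LowerBounds.
Variables (F : fieldType) (T N : nat -> nat).
Local Notation A := (chainAlg F T N).
Local Notation H := (unital_hull A).

Lemma codim_chain_gt0 n j : (n < N j)%N -> (0 < codim A n.+1)%N.
Proof.
move=> nN; have <- : #|[set tt]%SET| = 1%N by rewrite cards1.
pose pi (x : A) : F^o := x.2 j n.
pose one : A := (fun=> 1, fun _ _ => 1).
apply: (@codim_ge F A n.+1 _ [set tt]%SET (fun=> comb 1 (iota 2 n))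
  (fun _ _ => one) (fun=> 0%N) pi) => //.
- by move=> i _; rewrite navars_comb.
- move=> i _; rewrite /pi.
  have := @eval_comb F T N (fun=> one) 1 (iota 2 n) j 0.
  by rewrite !size_iota !add0n => ->//; rewrite big1 ?mulr1 ?oner_eq0.
- by move=> [] []; left.
Qed.

(** The whole chain [j] is a window of length [m].  Each injection [t] of its
    marked positions into the variables gives a word, with the remaining
    variables in increasing order, and a point: the variable at a marked
    position becomes the letter of that position, the others become the
    letter [0].  The word of [t'] does not vanish at the point of [t] only if
    [t'] and [t] agree. *)
Lemma codim_chain_ge m j : N j = m.+1 ->
  (m ^_ count (fun t => T j %| t)%N (iota 0 m) <= codim A m.+1)%N.
Proof.
move=> Nj; pose ts := iota 0 m; pose P t := (T j %| t)%N.
set k := count _ _.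
pose D : {set k.-tuple 'I_m} := [set t : k.-tuple 'I_m | all predT t & uniq t].
have cardD : #|D| = (m ^_ k)%N by rewrite card_uniq_tuples card_ord.
rewrite -cardD.
pose g (t : k.-tuple 'I_m) := [seq (nat_of_ord i).+2 | i <- t].
have sg t : size (g t) = k by rewrite size_map size_tuple.
pose r t := [seq x <- iota 2 m | x \notin g t].
pose p := map P ts.
have cp : count id p = k by rewrite count_map.
pose w t := comb 1 (fill p (g t) (r t)).
pose spots := [seq t <- ts | P t].
have sspots : size spots = k by rewrite size_filter.
pose marks := [seq q.+1 | q <- spots].
(* For an unmarked variable, [index] is out of range, and the default value of
   [nth] is the letter [0]. *)
pose phi (t : k.-tuple 'I_m) (x : nat) : A :=
  (fun L => (L == nth 0%N marks (index x (g t)))%:R,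
   fun _ _ => (x == 1%N)%:R).
pose pi (x : A) : F^o := x.2 j m.
have szp : size p = m by rewrite size_map size_iota.
have smarks : size marks = k by rewrite size_map.
have umarks : uniq marks.
  by rewrite map_inj_uniq ?filter_uniq ?iota_uniq// => ? ? [].
have ginj t : t \in D -> uniq (g t).
  rewrite inE => /andP[_ ut].
  by rewrite map_inj_uniq// => x y [] /val_inj.
have perm_gr t : t \in D -> perm_eq (g t ++ r t) (iota 2 m).
  move=> tD; apply: uniq_perm; last 1 first.
  - move=> x; rewrite mem_cat mem_filter.
    case: (boolP (x \in g t)) => //= /mapP[i _ ->].
    by rewrite mem_iota /= add2n !ltnS ltn_ord.
  - rewrite cat_uniq ginj// filter_uniq ?iota_uniq// andbT.
    by apply/hasPn => x; rewrite mem_filter => /andP[].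
  - exact: iota_uniq.
have sr t : t \in D -> size (r t) = count negb p.
  move=> tD; have := perm_size (perm_gr t tD).
  rewrite size_cat size_iota sg.
  have := count_predC id p; rewrite cp szp => <- /addnI ->.
  by apply: eq_count.
have vmask t t' : pi (naword_eval (phi t) (w t')) =
    (\prod_(q <- zip (g t') spots) (phi t q.1).1 (letter (T j) q.2)) *
    \prod_(x <- mask (map (predC P) ts) (fill p (g t') (r t')))
      (phi t x).1 0%N.
  rewrite /pi /w.
  have := @eval_comb F T N (phi t) 1 (fill p (g t') (r t')) j 0.
  rewrite add0n size_fill szp Nj => -> //=; rewrite mul1r.
  rewrite (@prod_zip_mask _ (fun x q => (phi t x).1 (letter (T j) q))
      (fun x => (phi t x).1 0%N) P).
  - by rewrite -/p mask_fill ?sg// /spots filter_mask.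
  - by rewrite size_fill szp size_iota.
  - by move=> x q /negPf; rewrite /P /letter => ->.
have lett q : q \in spots -> letter (T j) q = q.+1.
  by rewrite mem_filter /P /letter => /andP[-> _].
apply: (@codim_ge F A m.+1 _ D w phi (fun=> 0%N) pi) => //.
- move=> t tD; rewrite navars_comb -[iota 1 m.+1]/(1%N :: iota 2 m) perm_cons.
  by rewrite (permPl (perm_fill _ _)) ?sg ?sr ?perm_gr// cp.
- move=> t tD; rewrite vmask mulf_neq0//.
    rewrite prodf_seq_neq0; apply/allP => -[x q] /= /(nthP (0, 0)%N)[i].
    rewrite size_zip sg sspots minnn => ik.
    rewrite nth_zip ?sg ?sspots// => -[<- <-].
    rewrite lett ?mem_nth ?sspots// index_uniq ?sg ?ginj//.
    by rewrite (nth_map 0%N) ?sspots// eqxx oner_eq0.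
  rewrite prodf_seq_neq0; apply/allP => x.
  have -> : map (predC P) ts = map negb p by rewrite -map_comp.
  rewrite mask_negb_fill ?sr// mem_filter => /andP[xg _] /=.
  by rewrite (memNindex xg) [nth _ _ _]nth_default ?smarks ?sg// eqxx oner_eq0.
- move=> t t' tD t'D; rewrite vmask mulf_eq0 negb_or => /andP[nz _]; left.
  suff gE : g t' = g t.
    apply: val_inj; apply: (inj_map (f := fun i : 'I_m => i.+2)) gE.
    by move=> x y [] /val_inj.
  apply: (@eq_from_nth _ 0%N); first by rewrite !sg.
  move=> i; rewrite sg => ik; set y := nth 0%N (g t') i.
  move: nz; rewrite prodf_seq_neq0 => /allP /(_ (y, nth 0%N spots i)).
  rewrite /y -nth_zip ?sg ?sspots//.
  rewrite mem_nth ?size_zip ?sg ?sspots ?minnn//.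
  rewrite nth_zip ?sg ?sspots//= => /(_ isT).
  rewrite lett ?mem_nth ?sspots//.
  rewrite -(nth_map 0%N 0%N succn) ?sspots// -/marks -/y.
  have [+ _|_] := eqVneq (nth 0%N marks i) (nth 0%N marks (index y (g t)));
    last by rewrite eqxx.
  have [yg|yg] := boolP (y \in g t); last first.
    have -> : nth 0%N marks (index y (g t)) = 0%N.
      by rewrite (memNindex yg) nth_default// smarks sg.
    by rewrite /marks (nth_map 0%N) ?sspots.
  have ix : (index y (g t) < k)%N by rewrite -(sg t) index_mem.
  move=> /eqP; rewrite nth_uniq ?smarks// => /eqP iE.
  by rewrite [in RHS]iE nth_index.
Qed.

(** A letter kills vectors from the left and shifts them from the right; the
    element [1] fixes them from both sides. *)
Definition two_sided_point (K : pred nat) (x : nat) : H :=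
  if x == 1%N then (0, (0, fun _ _ => 1)) else
  if K x then (0, (fun=> 1, 0)) else (1, 0).

Lemma mul_chain_letter (z : nat -> nat -> F^o) :
  namul ((0, (0, z)) : H) (0, (fun=> 1, 0)) =
  (0, (0, fun j s => if s is s'.+1 then
                       if (s'.+1 < N j)%N then z j s' else 0 else 0)).
Proof.
rewrite hull_mul_inj; congr (0, (0, _)).
apply/funext => j; apply/funext => -[|s] //=.
by case: ifP => // _; exact: mulr1.
Qed.

Lemma mul_letter_chain (z : nat -> nat -> F^o) :
  namul ((0, (fun=> 1, 0)) : H) (0, (0, z)) = 0.
Proof. by rewrite hull_mul_inj chain_mul_letterless. Qed.

Lemma eval_two_sided (K L : pred nat) xs j
    (v := naword_eval (two_sided_point K) (two_sided L xs)) :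
  1%N \notin xs ->
  [/\ v.1 = 0, v.2.1 = 0 & forall s, (size xs <= s < N j)%N ->
    v.2.2 j s = (all (fun x => K x ==> L x) xs)%:R].
Proof.
rewrite {}/v; elim/last_ind: xs => [_|xs x IH]; first by split.
rewrite mem_rcons inE negb_or => /andP[x1 /IH].
rewrite two_sided_rcons all_rcons size_rcons andbC.
set v := naword_eval _ (two_sided L xs) => -[v1 v21 v22].
have px : two_sided_point K x = if K x then (0, (fun=> 1, 0)) else (1, 0).
  by rewrite /two_sided_point [x == _]eq_sym (negPf x1).
have vE : v = (0, (0, v.2.2)) by case: (v) v1 v21 => ? [? ?] /= -> ->.
set z := v.2.2 in vE v22.
have evalM (u u' : naword) : naword_eval (two_sided_point K) (NaMul u u') =
  namul (naword_eval (two_sided_point K) u)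
        (naword_eval (two_sided_point K) u') by [].
have evalx : naword_eval (two_sided_point K) (NaVar x) = two_sided_point K x.
  by [].
case: (L x); rewrite evalM -/v evalx px vE; case: (K x).
- rewrite mul_chain_letter; split=> // -[//|s] /andP[ls lt_N].
  by rewrite /= lt_N v22 ?andbT// -ltnS ls ltnW.
- rewrite hull_mul1r; split=> // s /andP[ls lt_N] /=.
  by rewrite v22 ?lt_N ?andbT// ltnW.
- by rewrite mul_letter_chain; split=> // s _; rewrite andbF.
- rewrite hull_mul1l; split=> // s /andP[ls lt_N] /=.
  by rewrite v22 ?lt_N ?andbT// ltnW.
Qed.

(** The value of the word of [L] at the point of [K] is nonzero if and only if
    [K] is a subset of [L], a triangular pattern. *)
Lemma codim_hull_ge n j : (n < N j)%N -> (2 ^ n <= codim H n.+1)%N.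
Proof.
move=> nN.
pose inb (K : {set 'I_n}) x := [exists i in K, x == (nat_of_ord i).+2].
have <- : #|powerset [set: 'I_n]%SET| = (2 ^ n)%N.
  by rewrite card_powerset cardsT card_ord.
pose pi (x : H) : F^o := x.2.2 j n.
pose word L := two_sided (inb L) (iota 2 n).
pose point K := two_sided_point (inb K).
have notin1 : 1%N \notin iota 2 n by rewrite mem_iota.
have val K L : pi (naword_eval (point K) (word L)) = (K \subset L)%:R.
  have [_ _ zE] := eval_two_sided (inb K) (inb L) j notin1.
  rewrite /pi zE ?size_iota ?leqnn//.
  congr (nat_of_bool _)%:R; apply/allP/fintype.subsetP => [all_in i iK|KL x _].
    have := all_in i.+2.
    rewrite mem_iota add2n !ltnS ltn_ord /= => /(_ isT)/implyP.
    have inK : inb K i.+2 by apply/existsP; exists i; rewrite iK eqxx.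
    move=> /(_ inK) /existsP[i' /andP[i'L]].
    by rewrite eqSS eqSS => /eqP/val_inj ->.
  apply/implyP => /existsP[i /andP[iK xi]]; apply/existsP; exists i.
  by rewrite (KL i).
apply: (@codim_ge F H n.+1 _ (powerset [set: 'I_n]%SET) word point
  (fun K => #|K|) pi).
- by move=> a x y; rewrite /pi hull_linear2 chain_linear2.
- by move=> K _; exact: perm_navars_two_sided.
- by move=> K _; rewrite val subxx oner_eq0.
- move=> K L _ _; rewrite val.
  case: (boolP (K \subset L)) => [KL _|]; last by rewrite eqxx.
  have := subset_leqif_cards KL => -[+ eqKL].
  by rewrite leq_eqVlt eqKL => /orP[/eqP|]; [left|right].
Qed.

End LowerBounds.

(** * Exponents and growth *)

Section UpperLimits.
Variable R : realType.
Implicit Types (u : (\bar R)^nat) (l x : R).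

Lemma limn_esup_le u l :
  (forall e, 0 < e -> exists k, forall n, (k <= n)%N ->
     (u n <= (l + e)%:E)%E) ->
  (limn_esup u <= l%:E)%E.
Proof.
move=> ul; apply/lee_addgt0Pr => e /ul[k uk].
apply: (@le_trans _ _ (ereal_sup (u @` [set n | (k <= n)%N]))).
  apply: ereal_inf_lbound; exists [set n | (k <= n)%N] => //.
  exact: nbhs_infty_ge.
by apply: ge_ereal_sup => _ [n kn <-]; rewrite -EFinD; exact: uk.
Qed.

Lemma limn_esup_ge u l :
  (forall e k, 0 < e -> exists2 n, (k <= n)%N & ((l - e)%:E <= u n)%E) ->
  (l%:E <= limn_esup u)%E.
Proof.
move=> ul; apply: le_ereal_inf_tmp => _ [V [k _ kV] <-].
apply/lee_subgt0Pr => e e0; have [n kn un] := ul e k e0.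
rewrite -EFinB; apply: le_trans un _; apply: ereal_sup_ubound; exists n => //.
exact: kV.
Qed.

Lemma limn_einf_ge u l :
  (forall e, 0 < e -> exists k, forall n, (k <= n)%N ->
     ((l - e)%:E <= u n)%E) ->
  (l%:E <= limn_einf u)%E.
Proof.
move=> ul; rewrite /limn_einf leeNr -EFinN; apply: limn_esup_le => e /ul[k uk].
by exists k => n /uk; rewrite -leeN2 -EFinN opprB addrC.
Qed.

Lemma limn_einf_le u l :
  (forall e k, 0 < e -> exists2 n, (k <= n)%N & (u n <= (l + e)%:E)%E) ->
  (limn_einf u <= l%:E)%E.
Proof.
move=> ul; rewrite /limn_einf leeNl -EFinN.
apply: limn_esup_ge => e k /(ul e k)[n kn un].
by exists n => //; rewrite -leeN2 oppeK -EFinN opprB opprK addrC.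
Qed.

End UpperLimits.

(** Errors are multiplicative in the following criteria, with a factor
    [x ^ n], [x > 1], so that they compose with products and no roots have to
    be taken. *)
Section ExponentCriteria.
Variables (R : realType) (F : fieldType) (A : nonAssocAlgType F).
Implicit Types (l x : R).
Local Notation c n := ((codim A n)%:R : R).

Lemma expr_root x n : 0 <= x -> (0 < n)%N -> (x ^+ n) `^ n%:R^-1 = x.
Proof.
move=> x0 n0; rewrite -powR_mulrn// -powRrM divff ?powRr1//.
by rewrite pnatr_eq0 -lt0n.
Qed.

Lemma codim_root_le x n : 0 <= x -> (0 < n)%N ->
  c n <= x ^+ n -> codim_root R A n <= x.
Proof.
move=> x0 n0 cx; rewrite -[leRHS](expr_root x0 n0) /codim_root.
by apply: ge0_ler_powR; rewrite ?invr_ge0 ?nnegrE ?exprn_ge0.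
Qed.

Lemma codim_root_ge x n : 0 <= x -> (0 < n)%N ->
  x ^+ n <= c n -> x <= codim_root R A n.
Proof.
move=> x0 n0 cx; rewrite -[leLHS](expr_root x0 n0) /codim_root.
by apply: ge0_ler_powR; rewrite ?invr_ge0 ?nnegrE ?exprn_ge0.
Qed.

Lemma upper_exp_le l : 0 < l ->
  (forall x, 1 < x -> exists k, forall n, (k <= n)%N ->
     c n <= (x * l) ^+ n) ->
  (upper_exp R A <= l%:E)%E.
Proof.
move=> l0 cl; apply: limn_esup_le => e e0.
have [|k ck] := cl (1 + e / l); first by rewrite ltrDl divr_gt0.
exists k.+1 => n kn; rewrite lee_fin; apply: codim_root_le.
- by rewrite addr_ge0 ?ltW.
- exact: leq_trans kn.
- by have := ck n (ltnW kn); rewrite mulrDl mul1r divfK ?gt_eqF.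
Qed.

Lemma lower_exp_le l : 0 < l ->
  (forall x k, 1 < x -> exists2 n, (k <= n)%N & c n <= (x * l) ^+ n) ->
  (lower_exp R A <= l%:E)%E.
Proof.
move=> l0 cl; apply: limn_einf_le => e k e0.
have [|n kn cn] := cl (1 + e / l) k.+1; first by rewrite ltrDl divr_gt0.
exists n; first exact: ltnW.
rewrite lee_fin; apply: codim_root_le.
- by rewrite addr_ge0 ?ltW.
- exact: leq_trans kn.
- by move: cn; rewrite mulrDl mul1r divfK ?gt_eqF.
Qed.

Lemma codim_root_ge_sub l e n : 0 < l -> 0 < e -> (0 < n)%N ->
  l ^+ n <= (1 + e / l) ^+ n * c n -> l - e <= codim_root R A n.
Proof.
move=> l0 e0 n0 cn; have x0 : 0 < 1 + e / l by rewrite addr_gt0 ?divr_gt0.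
apply: (@le_trans _ _ (l / (1 + e / l))).
  rewrite ler_pdivlMr// (_ : _ * _ = l - e ^+ 2 / l).
    by rewrite gerBl divr_ge0 ?sqr_ge0 ?ltW.
  by field; rewrite gt_eqF.
apply: codim_root_ge => //; first by rewrite divr_ge0 ?ltW.
by rewrite expr_div_n ler_pdivrMr ?exprn_gt0// mulrC.
Qed.

Lemma upper_exp_ge l : 0 < l ->
  (forall x k, 1 < x -> exists2 n, (k <= n)%N & l ^+ n <= x ^+ n * c n) ->
  (l%:E <= upper_exp R A)%E.
Proof.
move=> l0 cl; apply: limn_esup_ge => e k e0.
have [|n kn cn] := cl (1 + e / l) k.+1; first by rewrite ltrDl divr_gt0.
exists n; first exact: ltnW.
by rewrite lee_fin; apply: codim_root_ge_sub => //; exact: leq_trans kn.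
Qed.

Lemma lower_exp_ge l : 0 < l ->
  (forall x, 1 < x -> exists k, forall n, (k <= n)%N ->
     l ^+ n <= x ^+ n * c n) ->
  (l%:E <= lower_exp R A)%E.
Proof.
move=> l0 cl; apply: limn_einf_ge => e e0.
have [|k ck] := cl (1 + e / l); first by rewrite ltrDl divr_gt0.
exists k.+1 => n kn; rewrite lee_fin; apply: codim_root_ge_sub => //.
  exact: leq_trans kn.
by apply: ck; exact: ltnW.
Qed.

Lemma lower_upper_exp_cvg :
  cvgn (codim_root R A) -> lower_exp R A = upper_exp R A.
Proof.
move=> /cvg_ex[l cl].
have clE : (codim_root R A n)%:E @[n --> \oo] --> l%:E.
  by apply: cvg_EFin; first exact: nearW.
by rewrite /lower_exp /upper_exp !(cvg_limn_einf_sup clE).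
Qed.

End ExponentCriteria.

Section Growth.
Variable R : realType.
Implicit Types x y C : R.

Lemma bernoulli y n : 0 <= y -> 1 + y *+ n <= (1 + y) ^+ n.
Proof.
move=> y0; elim: n => [|n IH]; first by rewrite mulr0n addr0.
rewrite exprS mulrDl mul1r mulrSr addrA lerD// ler_peMr//.
by rewrite exprn_ege1// lerDl.
Qed.

(** With [y ^ (a + 1) = x], the inequality of Bernoulli bounds [x ^ n] from
    below by a constant times [n ^ (a + 1)]. *)
Lemma poly_le_exp x C a : 1 < x ->
  exists k, forall n, (k <= n)%N -> C * n%:R ^+ a <= x ^+ n.
Proof.
move=> x1; have x0 : 0 <= x by rewrite ltW// (lt_trans ltr01).
pose y := x `^ a.+1%:R^-1.
have y1 : 1 < y.
  suff : 1 `^ a.+1%:R^-1 < y by rewrite powR1.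
  by apply: gt0_ltr_powR; rewrite ?invr_gt0 ?nnegrE.
have yE : y ^+ a.+1 = x.
  by rewrite -powR_mulrn ?powR_ge0// -powRrM mulVf ?powRr1// pnatr_eq0.
pose d := (y - 1) ^+ a.+1; have d0 : 0 < d by rewrite exprn_gt0 // subr_gt0.
exists (Num.truncn (C / d)).+1 => n kn.
have Cn : C <= n%:R * d.
  rewrite -ler_pdivrMr//; apply: le_trans (ltW (truncnS_gt _)) _.
  by rewrite ler_nat.
rewrite -yE -exprM mulnC exprM.
apply: (@le_trans _ _ (n%:R ^+ a.+1 * d)).
  by rewrite exprS mulrAC ler_wpM2r ?exprn_ge0.
have y0 : 0 <= y - 1 by rewrite subr_ge0 ltW.
have ny : n%:R * (y - 1) <= y ^+ n.
  have := bernoulli n y0; rewrite [1 + (y - 1)]addrC subrK => ge_y.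
  by apply: le_trans ge_y; rewrite mulr_natl lerDr ler01.
rewrite -exprMn; apply: lerXn2r => //; rewrite nnegrE ?mulr_ge0//.
by apply: le_trans ny; rewrite mulr_ge0.
Qed.

Lemma const_le_exp x C : 1 < x ->
  exists k, forall n, (k <= n)%N -> C <= x ^+ n.
Proof.
by case/(@poly_le_exp x C 0) => k ck; exists k => n /ck; rewrite expr0 mulr1.
Qed.

Lemma sqrt_gt1 x : 1 < x -> exists2 y, 1 < y & y ^+ 2 = x.
Proof.
move=> x1; have x0 : 0 < x by rewrite (lt_trans ltr01).
exists (Num.sqrt x); last by rewrite sqr_sqrtr// ltW.
by rewrite -sqrtr1 ltr_sqrt.
Qed.

End Growth.

(** * The schedule of periods and lengths *)

Section BurstSchedule.
Variables (R : realType) (beta : R).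

Definition chain_length t := Num.truncn (beta ^+ t).

Fixpoint period j :=
  if j is j'.+1 then (chain_length (period j') ^ 2)%N else 4.

Definition burst j := chain_length (period j).

Local Notation T := period.
Local Notation N := burst.

Hypothesis beta_gt2 : 2 < beta.

Let beta_ge1 : 1 <= beta.
Proof. by rewrite ltW// (lt_trans _ beta_gt2)// ltr1n. Qed.

Let beta_gt0 : 0 < beta.
Proof. exact: lt_le_trans beta_ge1. Qed.

Lemma burst_le j : (N j)%:R <= beta ^+ T j.
Proof. by rewrite truncn_le exprn_ge0// ltW. Qed.

Lemma burst_gt j : beta ^+ T j < (N j).+1%:R.
Proof. exact: truncnS_gt. Qed.

Lemma period_lt_burst j : (T j < N j)%N.
Proof.
rewrite /burst /chain_length truncn_gt_nat.
apply: (@le_trans _ _ (2 ^+ T j)).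
  by rewrite -natrX ler_nat ltn_expl.
by apply: lerXn2r; rewrite ?nnegrE ltW.
Qed.

Lemma period_succ j : T j.+1 = (N j * N j)%N.
Proof. by rewrite /= expnS expn1. Qed.

Lemma burst_le_period j : (N j <= T j.+1)%N.
Proof.
by rewrite period_succ leq_pmulr// (leq_ltn_trans _ (period_lt_burst j)).
Qed.

Lemma period_mono : {homo T : i j / (i <= j)%N}.
Proof.
apply: homo_leq => // [? ? ?|j]; first exact: leq_trans.
exact: leq_trans (ltnW (period_lt_burst j)) (burst_le_period j).
Qed.

Lemma period_ge4 j : (4 <= T j)%N.
Proof. exact: (@period_mono 0). Qed.

Lemma period_gt j : (j < T j)%N.
Proof.
elim: j => // j IH; apply: leq_trans (burst_le_period j).
exact: leq_ltn_trans IH (period_lt_burst j).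
Qed.

Lemma burst_gt_index j : (j < N j)%N.
Proof. exact: ltn_trans (period_gt j) (period_lt_burst j). Qed.

Lemma burst_mono i j : (i <= j)%N -> (N i <= N j)%N.
Proof.
by move=> ij; apply: le_truncn; apply: ler_weXn2l => //; exact: period_mono.
Qed.

Lemma period_gap j n : (N j < n <= T j.+1)%N ->
  forall i, ~~ ((T i < n.-1) && (n.-1 < N i))%N.
Proof.
case/andP => Nn nT i; rewrite negb_and -!leqNgt; have [ij|ji] := leqP i j.
  by rewrite (leq_trans (burst_mono ij)) ?orbT// -ltnS (ltn_predK Nn).
by rewrite (leq_trans (leq_pred n))// (leq_trans nT)// period_mono.
Qed.

Local Notation D := (num_signatures T N).

Lemma signatures_le n : (D n)%:R <= (n ^ 4)%:R * beta ^+ n.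
Proof.
apply: num_signatures_le => // j; last exact: burst_le.
exact: leq_ltn_trans (period_gt j).
Qed.

(** Up to [N j] the previous bound applies, and beyond it there are only
    polynomially many signatures. *)
Lemma signatures_gap j n : (n <= T j.+1)%N ->
  (D n)%:R <= (T j.+1 ^ 4)%:R * beta ^+ N j.
Proof.
move=> nT; have [nN|Nn] := leqP n (N j).
  apply: le_trans (signatures_le n) _.
  rewrite ler_pM ?exprn_ge0 ?(ltW beta_gt0)//; last exact: ler_weXn2l.
  by rewrite ler_nat leq_exp2r.
apply: (@le_trans _ _ (n ^ 3)%:R).
  by rewrite ler_nat num_signatures_gap//; apply: (@period_gap j); rewrite Nn.
rewrite -[leLHS]mulr1 ler_pM ?ler0n ?ler01 ?exprn_ege1// ler_nat.
apply: (@leq_trans (T j.+1 ^ 3)); first by rewrite leq_exp2r.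
by rewrite leq_pexp2l// (leq_trans _ (period_ge4 _)).
Qed.

Variable F : fieldType.
Local Notation A := (chainAlg F T N).

Lemma codim_le_beta n : (codim A n)%:R <= (n ^ 4)%:R * beta ^+ n.
Proof.
apply: le_trans (signatures_le n); rewrite ler_nat.
exact: codim_chain_le period_gt n.
Qed.

Lemma codim_le_gap j : (codim A (T j.+1) <= T j.+1 ^ 3)%N.
Proof.
apply: leq_trans (@codim_chain_le F T N period_gt _) _.
apply: num_signatures_gap; apply: (@period_gap j).
rewrite leqnn andbT period_succ.
have := period_ge4 j; have := period_lt_burst j; nia.
Qed.

Lemma codim_hull_le_beta n :
  (codim (unital_hull A) n)%:R <= 1 + (n ^ 4)%:R * (beta + 1) ^+ n.
Proof.
apply: (@le_trans _ _ (1 + \sum_(vs <- sublists (iota 1 n)) (D (size vs))%:R)).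
  by rewrite -natr_sum addrC natr1 ler_nat; exact: codim_hull_le period_gt n.
have -> : (beta + 1) ^+ n = \sum_(vs <- sublists (iota 1 n)) beta ^+ size vs.
  by rewrite sum_sublists_expr size_iota.
rewrite lerD2l mulr_sumr !big_seq.
apply: ler_sum => vs /size_mem_sublists; rewrite size_iota => szn.
apply: le_trans (signatures_le _) _.
by rewrite ler_wpM2r ?exprn_ge0 ?(ltW beta_gt0)// ler_nat leq_exp2r.
Qed.

Lemma codim_hull_le_gap j (n := T j.+1) :
  (codim (unital_hull A) n)%:R <= 1 + 2 ^+ n * ((n ^ 4)%:R * beta ^+ N j).
Proof.
apply: (@le_trans _ _ (1 + \sum_(vs <- sublists (iota 1 n)) (D (size vs))%:R)).
  by rewrite -natr_sum addrC natr1 ler_nat; exact: codim_hull_le period_gt n.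
pose b := (n ^ 4)%:R * beta ^+ N j.
rewrite lerD2l; apply: (@le_trans _ _ (\sum_(vs <- sublists (iota 1 n)) b)).
  rewrite !big_seq; apply: ler_sum => vs /size_mem_sublists.
  by rewrite size_iota => szn; exact: signatures_gap.
rewrite big_const_seq count_predT iter_addr_0 size_sublists size_iota.
by rewrite -[leLHS]mulr_natl natrX.
Qed.

(** With [m = n - 1] positions and [k >= m / T j] marks, the codimension is at
    least [(m - k) ^ k].  Here [m - k] is at least [n / 4], hence at least
    [beta ^ (T j) / 8], because [n] is [beta ^ (T j)] rounded down. *)
Lemma codim_ge_beta j (n := N j) :
  beta ^+ n <= beta * 8 ^+ (n %/ T j).+1 * (codim A n)%:R.
Proof.
have T4 := period_ge4 j; have TN := period_lt_burst j.
have T0 : (0 < T j)%N by exact: leq_trans T4.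
have nm : n = n.-1.+1 by rewrite (ltn_predK TN).
set m := n.-1 in nm; pose k := count (fun t => T j %| t)%N (iota 0 m).
have k_le : (k <= m %/ T j + 1)%N.
  by have := count_multiples_le 0 m T0.
have k_ge : (m <= T j * k)%N := leq_count_multiples m T0.
have c_ge : ((m - k) ^ k <= codim A n)%N.
  rewrite nm; apply: leq_trans (leq_exp_ffact m k) _.
  by apply: (@codim_chain_ge F T N m j); rewrite -nm.
have mk : (n <= 4 * (m - k))%N.
  have : (m %/ T j <= m %/ 4)%N by exact: leq_div2l.
  have := leq_divM m 4; move: nm TN T4 k_le; rewrite -/n; lia.
have beta_mk : beta ^+ T j <= 8 * (m - k)%:R.
  apply: ltW; apply: lt_le_trans (burst_gt j) _.
  rewrite -natrM ler_nat -/n; move: mk TN T4; rewrite -/n; lia.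
rewrite {1}nm exprS -mulrA ler_pM2l//.
apply: (@le_trans _ _ ((beta ^+ T j) ^+ k)); first by rewrite -exprM ler_weXn2l.
apply: (@le_trans _ _ ((8 * (m - k)%:R) ^+ k)).
  by apply: lerXn2r; rewrite ?nnegrE ?mulr_ge0 ?exprn_ge0// ltW.
rewrite exprMn ler_pM ?exprn_ge0//; last by rewrite -natrX ler_nat.
rewrite ler_weXn2l ?ler1n// (leq_trans k_le)// addn1 ltnS leq_div2r//.
exact: leq_pred.
Qed.

Lemma codim_chain_burst (x : R) k : 1 < x ->
  exists2 n, (k <= n)%N & beta ^+ n <= x ^+ n * (codim A n)%:R.
Proof.
(* Half of the factor [x ^ n] absorbs the constant [beta * 8], the other half
   absorbs [8 ^ (n / T j)]. *)
move=> x1; have [y y1 yx] := sqrt_gt1 x1.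
have [k1 ck1] := const_le_exp (beta * 8) y1.
have [k2 ck2] := const_le_exp 8 y1.
pose j := maxn k (maxn k1 k2).
have jT : (j <= T j)%N by exact/ltnW/period_gt.
have jN : (j <= N j)%N by exact/ltnW/burst_gt_index.
have [kj k1j k2j] : [/\ (k <= j)%N, (k1 <= j)%N & (k2 <= j)%N].
  by rewrite /j; split; lia.
exists (N j); first exact: leq_trans jN.
apply: le_trans (codim_ge_beta j) _.
have y0 : 0 <= y by rewrite ltW// (lt_trans ltr01).
rewrite ler_wpM2r// exprS mulrA -yx -exprM mulnC exprM expr2.
rewrite ler_pM ?mulr_ge0 ?exprn_ge0// ?(ltW beta_gt0)//.
  exact: ck1 (leq_trans k1j jN).
apply: (@le_trans _ _ ((y ^+ T j) ^+ (N j %/ T j))).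
  by apply: lerXn2r; rewrite ?nnegrE ?exprn_ge0// ck2// (leq_trans k2j).
by rewrite -exprM ler_weXn2l ?(ltW y1)// mulnC leq_divM.
Qed.

(** * The exponents of the algebra and of its unital hull *)

Lemma chain_lower_exp : lower_exp R A = 1%:E.
Proof.
apply/eqP; rewrite eq_le; apply/andP; split.
  apply: lower_exp_le => // x k x1; have [k' ck] := poly_le_exp 1 3 x1.
  have kT : (maxn k k' <= T (maxn k k').+1)%N.
    by apply/ltnW/ltnW; exact: period_gt.
  exists (T (maxn k k').+1); first exact: leq_trans (leq_maxl _ _) kT.
  rewrite mulr1; apply: le_trans (ck _ (leq_trans (leq_maxr _ _) kT)).
  by rewrite mul1r -natrX ler_nat codim_le_gap.
apply: lower_exp_ge => // x x1; exists 1%N => -[//|n] _; rewrite expr1n.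
have c1 : 1 <= (codim A n.+1)%:R :> R.
  by rewrite ler1n (@codim_chain_gt0 F T N n n (burst_gt_index n)).
by rewrite -[leLHS](mulr1 1) ler_pM// exprn_ege1// ltW.
Qed.

Lemma chain_upper_exp : upper_exp R A = beta%:E.
Proof.
apply/eqP; rewrite eq_le; apply/andP; split.
  apply: upper_exp_le => // x x1; have [k ck] := poly_le_exp 1 4 x1.
  exists k => n /ck nk; apply: le_trans (codim_le_beta n) _.
  rewrite exprMn ler_wpM2r ?exprn_ge0 ?(ltW beta_gt0)//.
  by rewrite natrX; move: nk; rewrite mul1r.
by apply: upper_exp_ge => // x k; exact: codim_chain_burst.
Qed.

Lemma hull_lower_exp : lower_exp R (unital_hull A) = 2%:E.
Proof.
apply/eqP; rewrite eq_le; apply/andP; split.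
  apply: lower_exp_le => // x k x1; have [y y1 yx] := sqrt_gt1 x1.
  have [k1 ck1] := poly_le_exp 2 4 y1; have [k2 ck2] := const_le_exp beta y1.
  pose j := maxn k (maxn k1 k2); pose n := T j.+1.
  have jn : (j <= n)%N by apply/ltnW/ltnW; exact: period_gt.
  have jN : (j <= N j)%N by exact/ltnW/burst_gt_index.
  have [kj k1j k2j] : [/\ (k <= j)%N, (k1 <= j)%N & (k2 <= j)%N].
    by rewrite /j; split; lia.
  exists n; first exact: leq_trans jn.
  apply: le_trans (codim_hull_le_gap j) _; rewrite -/n.
  have y0 : 0 <= y by rewrite ltW// (lt_trans ltr01).
  have n0 : (0 < n)%N by exact: leq_trans (period_ge4 _).
  have big : 1 <= 2 ^+ n * ((n ^ 4)%:R * beta ^+ N j).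
    rewrite -[leLHS](mulr1 1) ler_pM// ?exprn_ege1// ?ler1n//.
    by rewrite -[leLHS](mulr1 1) ler_pM// ?exprn_ege1// ler1n expn_gt0 n0.
  apply: (@le_trans _ _ (2 ^+ n * ((2 * n%:R ^+ 4) * beta ^+ N j))).
    set z := 2 ^+ n * _ in big *.
    have -> : 2 ^+ n * (2 * n%:R ^+ 4 * beta ^+ N j) = z + z.
      by rewrite /z natrX; ring.
    by rewrite lerD2r.
  rewrite mulrC exprMn ler_wpM2r ?exprn_ge0// -yx -exprM mulnC exprM expr2.
  rewrite ler_pM ?mulr_ge0 ?exprn_ge0// ?(ltW beta_gt0)//.
    exact: ck1 (leq_trans k1j jn).
  (* The next period is the square of [N j]. *)
  apply: (@le_trans _ _ ((y ^+ N j) ^+ N j)).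
    apply: lerXn2r; rewrite ?nnegrE ?exprn_ge0 ?(ltW beta_gt0)//.
    by rewrite ck2// (leq_trans k2j).
  by rewrite -exprM /n period_succ.
apply: lower_exp_ge => // x x1; have [k ck] := const_le_exp 2 x1.
exists k.+1 => -[//|n] kn; rewrite exprS ler_pM ?exprn_ge0//.
  exact/ck/ltnW.
by rewrite -natrX ler_nat (@codim_hull_ge F T N n n (burst_gt_index n)).
Qed.

Lemma hull_upper_exp_ge : (beta%:E <= upper_exp R (unital_hull A))%E.
Proof.
apply: upper_exp_ge => // x k x1; have [n kn cn] := codim_chain_burst k x1.
exists n => //; apply: le_trans cn _; rewrite ler_wpM2l ?exprn_ge0//.
  by rewrite ltW// (lt_trans ltr01).
by rewrite ler_nat codim_le_hull.
Qed.

Lemma hull_upper_exp_le : (upper_exp R (unital_hull A) <= (beta + 1)%:E)%E.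
Proof.
have b0 : 0 < beta + 1 by rewrite addr_gt0.
apply: upper_exp_le => // x x1; have [k ck] := poly_le_exp 2 4 x1.
exists k.+1 => n kn; apply: le_trans (codim_hull_le_beta n) _.
have n0 : (0 < n)%N by exact: leq_trans kn.
rewrite exprMn; apply: (@le_trans _ _ ((2 * n%:R ^+ 4) * (beta + 1) ^+ n)).
  rewrite -mulrA mulrDl mul1r natrX lerD2r -[leLHS](mulr1 1) ler_pM//.
    by rewrite exprn_ege1// ler1n.
  by rewrite exprn_ege1// lerDr ltW.
by rewrite ler_wpM2r ?exprn_ge0 ?(ltW b0)// ck// ltnW.
Qed.

Lemma hull_exp_diverges : ~ cvgn (codim_root R (unital_hull A)).
Proof.
move=> /lower_upper_exp_cvg; rewrite hull_lower_exp => E.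
by move: hull_upper_exp_ge; rewrite -E lee_fin leNgt beta_gt2.
Qed.

End BurstSchedule.

Theorem corollary3p1 (R : realType) (F : fieldType)
    (charF : [pchar F] =i pred0) (beta : R) (beta_gt2 : 2 < beta) :
  exists A : nonAssocAlgType F,
    [/\ lower_exp R A = 1%:E,
        upper_exp R A = beta%:E,
        ~ cvgn (codim_root R (unital_hull A)),
        lower_exp R (unital_hull A) = 2%:E &
        (beta%:E <= upper_exp R (unital_hull A) <= (beta + 1)%:E)%E].
Proof.
exists (chainAlg F (period beta) (burst beta)); split.
- exact: chain_lower_exp.
- exact: chain_upper_exp.
- exact: hull_exp_diverges.
- exact: hull_lower_exp.
- by apply/andP; split; [exact: hull_upper_exp_ge|exact: hull_upper_exp_le].
Qed.
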